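(* Let $A\in\mathbb{C}^{n\times n}$, $u,v\in\mathbb{C}^n$, let $m_A(\lambda)$ be the minimal polynomial of $A$, let $l\in\mathbb{N}$ be its degree, and let $p_{uv}(\lambda)=v^*m_A(\lambda)(\lambda I_n-A)^{-1}u$ (a polynomial in $\lambda$). For $\tau\in\mathbb{C}$ write $B(\tau)=A+\tau uv^*$. If $v^*u=v^*Au=\cdots=v^*A^{l-1}u=0$, then $p_{uv}(\lambda)\equiv 0$ and $\sigma(A+\tau uv^* )=\sigma(A)$ for every $\tau\in\mathbb{C}$. If, for some $\kappa\in\{0,\dots,l-1\}$, $$v^*u=\cdots=v^*A^{\kappa-1}u=0,\qquad v^*A^{\kappa}u\neq 0,$$ then the following statements hold. (i) $p_{uv}(\lambda)$ is of degree $l-\kappa-1$. (ii) $l-\kappa-1$ eigenvalues of $B(\tau)$ converge to the roots of $p_{uv}(\lambda)$ (eigenvalues and roots counted with multiplicity) as $\tau\to\infty$. (iii) There are $\kappa+1$ eigenvalues $\lambda_1(\tau),\dots,\lambda_{\kappa+1}(\tau)$ of $A+\tau uv^*$ having the following Puiseux expansion at $\tau=\infty$: $$\lambda_j(\tau)=c_{-1}\tau^{\frac{1}{\kappa+1}}+c_0+c_1\tau^{-\frac{1}{\kappa+1}}+\cdots,\qquad j=1,\dots,\kappa+1,$$ where $$c_{-1}=(v^*A^\kappa u)^{\frac{1}{\kappa+1}},\qquad c_0=\frac{1}{\kappa+1}\cdot\frac{v^*A^{\kappa+1}u}{v^*A^\kappa u},$$ $$c_1=\frac{1}{\kappa+1}\cdot\frac{1}{(v^*A^\kappa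 u)^{1+\frac{1}{\kappa+1}}}\cdot\left(v^*A^{\kappa+2}u-\frac{\kappa+2}{2(\kappa+1)}\cdot\frac{(v^*A^{\kappa+1}u)^2}{v^*A^\kappa u}\right).$$ (iv) If $\zeta$ is a root of $p_{uv}(\lambda)$ of multiplicity $k$ and $\zeta$ is not a root of $m_A(\lambda)$, then there are $k$ eigenvalues of $A+\tau uv^*$ converging to $\zeta$ as $\tau\to\infty$ and having the following Puiseux expansion at $\tau=\infty$: $$\lambda_j(\tau)=\zeta-b_1\tau^{-\frac1k}-b_2\tau^{-\frac2k}-b_3\tau^{-\frac3k}-\cdots,\qquad j=1,\dots,k,$$ where, with $a_m=a_m(\zeta)=v^*(\zeta I_n-A)^{-m}u$ for $m\ge 0$, one has $a_{k+1}\neq 0$ and $$b_1=b_1(\zeta)=a_{k+1}^{-\frac1k},\qquad b_2=b_2(\zeta)=-\frac1k\cdot\frac{b_1^2\,a_{k+2}}{a_{k+1}}.$$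
   Context: $\sigma(M)$ denotes the set of eigenvalues of a square matrix $M$; $v^*$ is the conjugate transpose of $v$; $\tau\to\infty$ means $|\tau|\to\infty$ in $\mathbb{C}$. Convention on roots in Puiseux series: one fixed $(\kappa+1)$-th root of $v^*A^\kappa u$ is chosen as $c_{-1}=(v^*A^\kappa u)^{1/(\kappa+1)}$, and $(v^*A^\kappa u)^{1+1/(\kappa+1)}$ means $c_{-1}\cdot v^*A^\kappa u$; similarly, $b_1=a_{k+1}^{-1/k}$ is one fixed $k$-th root of $1/a_{k+1}$. The index $j$ of the eigenvalue corresponds to the choice of the root of $\tau$: the expansion in (iii) means that there is a Laurent series $f(z)=c_{-1}z+c_0+c_1z^{-1}+\cdots$, convergent for all $z\in\mathbb{C}$ with $|z|$ sufficiently large, such that for $|\tau|$ sufficiently large the eigenvalues $\lambda_1(\tau),\dots,\lambda_{\kappa+1}(\tau)$ are the values $f(z_1),\dots,f(z_{\kappa+1})$, where $z_1,\dots,z_{\kappa+1}$ are the $\kappa+1$ distinct complex $(\kappa+1)$-th roots of $\tau$. Likewise the expansion in (iv) means that there is a power series $g(w)=\zeta-b_1w-b_2w^2-\cdots$, convergent for $|w|$ sufficiently small, such that for $|\tau|$ sufficiently large the $k$ eigenvalues are $g(w_1),\dots,g(w_k)$, where $w_1,\dots,w_k$ are the $k$ distinct complex $k$-th roots of $1/\tau$. *)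

(* Defs.v *)
From HB Require Import structures.
From mathcomp Require Export all_boot all_order all_algebra.
From mathcomp Require Export complex.
From mathcomp Require Export boolp classical_sets reals topology normedtype.
From mathcomp Require Export sequences.

Set Implicit Arguments.
Unset Strict Implicit.
Unset Printing Implicit Defensive.

Export Order.TTheory GRing.Theory Num.Theory numFieldNormedType.Exports.
Global Open Scope classical_set_scope.
Global Open Scope ring_scope.
Global Open Scope complex_scope.
Global Open Scope sesquilinear_scope.

(* Bundling R[i] as a numClosedFieldType lets the norm topology be inferred: it
   is attached to that structure and not to the head symbol of R[i]. *)
Definition Cplx (R : realType) : numClosedFieldType := R[i].

(* Here `|x| and the bound M live in C; without M \is Num.real the condition
   M < `|x| would be vacuous for non-real M. *)
Definition infty_nbhs (C : numClosedFieldType) : set_system C :=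
  [set P | exists2 M : C, M \is Num.real & forall x, M < `|x| -> P x].
Arguments infty_nbhs C : clear implicits.

#[global] Instance infty_nbhs_filter (C : numClosedFieldType) :
  ProperFilter (infty_nbhs C).
Proof.
split.
  case=> M Mr /(_ (`|M| + 1)); apply.
  rewrite [X in _ < X]ger0_norm ?addr_ge0//.
  by rewrite (le_lt_trans (real_ler_norm Mr))// ltrDl.
split; first by exists 0.
- move=> P Q [M Mr MP] [N Nr NQ]; exists (`|M| + `|N|).
    by rewrite realD// normr_real.
  move=> x MNx; split; [apply: MP | apply: NQ]; apply: le_lt_trans MNx.
    by rewrite (le_trans (real_ler_norm Mr))// lerDl.
  by rewrite (le_trans (real_ler_norm Nr))// lerDr.
- by move=> P Q PQ [M Mr MP]; exists M => // x /MP /PQ.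
Qed.

Definition tends_at_infty (C : numClosedFieldType) (f : C -> C) (l : C) :=
  f @ infty_nbhs C --> l.

Section Matrices.
Variables (C : numClosedFieldType) (n : nat).
Implicit Types (A M : 'M[C]_n.+1) (u v : 'cV[C]_n.+1).

Definition sigma M : set C := [set x | eigenvalue M x].

Definition moment A u v (i : nat) : C := (v ^t* *m A ^+ i *m u) 0 0.

Definition resolvent_moment A u v (zeta : C) (m : nat) : C :=
  (v ^t* *m (zeta%:M - A) ^- m *m u) 0 0.

Definition rank_one_update A u v (tau : C) : 'M[C]_n.+1 :=
  A + tau *: (u *m v ^t*).

(* The identity is required where lambda I - A is invertible, that is, at all
   but finitely many lambda, so it determines p. *)
Definition is_puv A u v (p : {poly C}) : Prop :=
  forall lambda : C, lambda%:M - A \is a GRing.unit ->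
    p.[lambda] =
      (v ^t* *m ((mxminpoly A).[lambda] *: (lambda%:M - A)^-1) *m u) 0 0.

(* The family lam is a sub-multiset of the spectrum of M, where eigenvalues are
   counted with algebraic multiplicity. *)
Definition eigenvalue_family M (k : nat) (lam : 'I_k -> C) : Prop :=
  forall x : C, (#|[pred i | lam i == x]| <= mup x (char_poly M))%N.

End Matrices.

Section Expansions.
Variable C : numClosedFieldType.

Definition root_family (p : {poly C}) (k : nat) (r : 'I_k -> C) : Prop :=
  forall x : C, #|[pred i | r i == x]| = mup x p.

(* As k values are distinct, z enumerates all k-th roots of x when x != 0. *)
Definition distinct_kth_roots (k : nat) (x : C) (z : 'I_k -> C) : Prop :=
  injective z /\ forall j, z j ^+ k = x.

(* f(z) = c_0 z + c_1 + c_2 z^-1 + ...; indices are shifted by one, so that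
   c m is the coefficient of z^(1 - m). *)
Definition laurent_at_infty (f : C -> C) (c : nat -> C) : Prop :=
  \forall z \near infty_nbhs C,
    (fun N => \sum_(0 <= m < N) c m * z ^ (1 - m%:Z)) @ \oo --> f z.

(* g(w) = zeta - b_1 w - b_2 w^2 - ...; the value b 0 is not used. *)
Definition power_series_at_0 (g : C -> C) (zeta : C) (b : nat -> C) : Prop :=
  \forall w \near (0 : C),
    (fun N => zeta - \sum_(1 <= m < N) b m * w ^+ m) @ \oo --> g w.

End Expansions.

(* Main.v *)
Require Import Defs.
From mathcomp Require Import ring separable.

Set Implicit Arguments.
Unset Strict Implicit.
Unset Printing Implicit Defensive.

(* Let m be the minimal polynomial of A and p = p_uv. The matrix determinant
   lemma gives m * char_poly (B tau) = char_poly A * (m - tau p), so every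
   divisor of m - tau p divides char_poly (B tau) and only the roots of
   m - tau p matter.

   Near a root zeta of p of order k, substitute lambda = zeta - w y with
   w^k = 1/tau; near infinity, lambda = y / w with w^(kappa+1) = 1/tau. After
   clearing powers of w the equation becomes G(w, y) = 0, with G a polynomial
   and G(0, y) having simple nonzero roots, so y is an analytic function of w.
   Its power series is the fixed point of a Picard iteration on truncated
   polynomials, and it converges because the iteration preserves a ball of the
   submultiplicative norm sum |p_i| r^i. The k values of w yield k distinct
   roots, and the first coefficients of y are read off from G(w, y) = 0 modulo
   w^2 or w^3, using the expansion of p / m at zeta or at infinity.

   For (ii), a root zeta of p that is also a root of m is treated after dividing
   m - tau p by a power of lambda - zeta, which contributes eigenvalues that
   stay at zeta. *)

(** * Formal implicit function theorem *)

Section Wnorm.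
Variable C : numFieldType.
Implicit Types (p q T : {poly C}) (r : C).

(* A submultiplicative norm; it plays the role of a majorant series. *)
Definition wnorm r p : C := \sum_(i < size p) `|p`_i| * r ^+ i.

Lemma wnorm_wide r p N : (size p <= N)%N ->
  wnorm r p = \sum_(i < N) `|p`_i| * r ^+ i.
Proof.
move=> pN; rewrite /wnorm (big_ord_widen _ (fun i => `|p`_i| * r ^+ i) pN).
rewrite big_mkcond; apply: eq_bigr => i _; case: ltnP => // pi.
by rewrite nth_default// normr0 mul0r.
Qed.

Lemma wnorm_ge0 r p : 0 <= r -> 0 <= wnorm r p.
Proof. by move=> r0; apply: sumr_ge0 => i _; rewrite mulr_ge0// exprn_ge0. Qed.

Lemma wnormC r a : wnorm r a%:P = `|a|.
Proof.
by rewrite (@wnorm_wide _ _ 1) ?size_polyC_leq1// big_ord1 coefC mulr1.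
Qed.

Lemma wnormD r p q : 0 <= r -> wnorm r (p + q) <= wnorm r p + wnorm r q.
Proof.
move=> r0; pose N := maxn (size p) (size q).
rewrite !(@wnorm_wide _ _ N) ?leq_maxl ?leq_maxr ?size_polyD//.
rewrite -big_split; apply: ler_sum => i _ /=.
by rewrite -mulrDl ler_wpM2r ?exprn_ge0// coefD ler_normD.
Qed.

Lemma wnorm_sum r n (F : 'I_n -> {poly C}) : 0 <= r ->
  wnorm r (\sum_i F i) <= \sum_i wnorm r (F i).
Proof.
move=> r0; elim/big_rec2: _ => [|i a b _ ab]; first by rewrite wnormC normr0.
by rewrite (le_trans (wnormD _ _ r0))// lerD2l.
Qed.

(** [wnorm r p] is the value at r of the majorant with coefficients |p_i|; the bound is then the
    triangle inequality on each convolution coefficient. *)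
Lemma wnormM r p q : 0 <= r -> wnorm r (p * q) <= wnorm r p * wnorm r q.
Proof.
pose a p := \poly_(i < size p) `|p`_i|.
have coefa u i : (a u)`_i = `|u`_i|.
  by rewrite coef_poly; case: ltnP => // ui; rewrite nth_default ?normr0.
have aE u : wnorm r u = (a u).[r].
  rewrite (@horner_coef_wide _ (size u)) ?size_poly//.
  by apply: eq_bigr => i _; rewrite coefa.
move=> r0; rewrite (aE p) (aE q) -hornerM.
pose N := maxn (size (p * q)) (size (a p * a q)).
rewrite (@wnorm_wide _ _ N) ?leq_maxl//.
rewrite (@horner_coef_wide _ N) ?leq_maxr//.
apply: ler_sum => i _; rewrite ler_wpM2r ?exprn_ge0// !coefM.
apply: le_trans (ler_norm_sum _ _ _) _; apply: ler_sum => j _.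
by rewrite normrM !coefa.
Qed.

Lemma wnormX r p n : 0 <= r -> wnorm r (p ^+ n) <= wnorm r p ^+ n.
Proof.
move=> r0; elim: n => [|n IHn]; first by rewrite !expr0 wnormC normr1.
rewrite !exprS (le_trans (wnormM _ _ r0))// ler_wpM2l// wnorm_ge0//.
Qed.

Lemma wnorm_take r p n : 0 <= r -> wnorm r (take_poly n p) <= wnorm r p.
Proof.
move=> r0; pose N := maxn (size (take_poly n p)) (size p).
rewrite !(@wnorm_wide _ _ N) ?leq_maxl ?leq_maxr//.
apply: ler_sum => i _; rewrite ler_wpM2r ?exprn_ge0// coef_take_poly.
by case: ifP; rewrite ?normr0.
Qed.

Lemma wnorm_horner r (H : {poly {poly C}}) T rho : 0 <= r ->
  wnorm r T <= rho -> wnorm r H.[T] <= \sum_(j < size H) wnorm r H`_j * rho ^+ j.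
Proof.
move=> r0 Trho; rewrite horner_coef (le_trans (wnorm_sum _ r0))//.
apply: ler_sum => j _; rewrite (le_trans (wnormM _ _ r0))//.
rewrite ler_wpM2l ?wnorm_ge0// (le_trans (wnormX _ _ r0))//.
by rewrite lerXn2r// nnegrE ?wnorm_ge0// (le_trans _ Trho)// wnorm_ge0.
Qed.

Lemma wnorm_le1 r p : 0 <= r -> r <= 1 -> wnorm r p <= wnorm 1 p.
Proof.
move=> r0 r1; apply: ler_sum => i _; rewrite ler_wpM2l// expr1n.
exact: exprn_ile1.
Qed.

Lemma wnorm_small r p : 0 <= r -> r <= 1 -> p`_0 = 0 ->
  wnorm r p <= r * wnorm 1 p.
Proof.
move=> r0 r1 p0; rewrite /wnorm mulr_sumr; apply: ler_sum => -[[|i] i_p] _ /=.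
  by rewrite p0 normr0 !mul0r mulr0.
rewrite expr1n mulr1 mulrC ler_wpM2r// exprS.
by rewrite -[leRHS]mulr1 ler_wpM2l// exprn_ile1.
Qed.

(** Writing p = q X^N, the factor X^N contributes exactly r^N to the norm and |w|^N to the value.
    This turns divisibility by a high power of X into smallness of values inside the disc. *)
Lemma norm_horner_le_wnorm r p w N : 0 < r -> 'X^N %| p -> `|w| <= r ->
  `|p.[w]| <= (`|w| / r) ^+ N * wnorm r p.
Proof.
move=> r0 /(Pdiv.Field.dvdpP) [q ->] wr.
rewrite hornerM hornerXn normrM normrX.
suff -> : wnorm r (q * 'X^N) = wnorm r q * r ^+ N.
  rewrite expr_div_n mulrACA mulVf ?mulr1 ?expf_neq0 ?gt_eqF//.
  rewrite mulrC ler_wpM2l ?exprn_ge0//.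
  rewrite horner_coef (le_trans (ler_norm_sum _ _ _))//.
  by apply: ler_sum => i _; rewrite normrM normrX ler_wpM2l// lerXn2r ?nnegrE// ltW.
have sz : (size (q * 'X^N)%R <= N + size q)%N.
  by rewrite (leq_trans (size_polyMleq _ _))// size_polyXn addnS addnC.
rewrite (wnorm_wide _ sz) big_split_ord /= big1 ?add0r => [|i _]; last first.
  by rewrite coefMXn ltn_ord normr0 mul0r.
rewrite /wnorm mulr_suml; apply: eq_bigr => i _.
by rewrite coefMXn ltnNge leq_addr/= addKn exprD mulrCA mulrC.
Qed.

End Wnorm.

Section Implicit.
Variable C : numFieldType.

Lemma contraction_radius (H : {poly {poly C}}) :
  H`_0`_0 = 0 -> H`_1`_0 = 0 ->
  exists r rho : C, [/\ 0 < r, 0 < rho &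
    \sum_(j < size H) wnorm r H`_j * rho ^+ j <= rho].
Proof.
move=> H00 H10; pose B := 1 + \sum_(j < size H) wnorm 1 H`_j.
have B1 : 1 <= B by rewrite lerDl sumr_ge0// => j _; rewrite wnorm_ge0.
have B0 : 0 < B by rewrite (lt_le_trans _ B1).
have B20 : 0 < 2 * B by rewrite mulr_gt0.
(* The terms of index 0 and 1 are O(r) because their coefficients have no constant term, and those
   of index j >= 2 because rho^j <= rho^2 = r. The sum is thus at most r B = rho / 2. *)
pose rho : C := (2 * B)^-1; pose r := rho ^+ 2.
have rho0 : 0 < rho by rewrite invr_gt0.
have rho1 : rho <= 1.
  by rewrite invf_le1// -[leLHS]mul1r ler_pM// ler1n.
have r0 : 0 < r by rewrite exprn_gt0.
have r1 : r <= 1 by rewrite exprn_ile1// ltW.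
exists r, rho; split=> //.
have /le_trans : \sum_(j < size H) wnorm r H`_j * rho ^+ j <= r * B.
  rewrite mulrDr mulr1 -[leLHS]add0r lerD ?(ltW r0)// mulr_sumr.
  apply: ler_sum => -[[|[|j]] jH] _ /=.
  - by rewrite mulr1 wnorm_small// ltW.
  - apply: le_trans (wnorm_small (ltW r0) r1 H10).
    by rewrite -[leRHS]mulr1 ler_wpM2l// wnorm_ge0 ?ltW.
  - rewrite mulrC; apply: ler_pM; first exact: exprn_ge0 (ltW rho0).
    + exact: wnorm_ge0 (ltW r0).
    + by rewrite ler_wiXn2l// ltW.
    + exact: wnorm_le1 (ltW r0) r1.
apply; rewrite /r expr2 -mulrA -[leRHS]mulr1 ler_wpM2l ?(ltW rho0)//.
rewrite /rho invfM -mulrA mulVf ?gt_eqF// mulr1 invf_le1//.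
by rewrite ler1n.
Qed.

(* Picard iteration for the fixed point T = H(T), truncated so that each
   iterate is a polynomial; the bound on the weighted norm survives
   truncation. *)
Fixpoint picard (H : {poly {poly C}}) n : {poly C} :=
  if n is n'.+1 then take_poly n'.+1 H.[picard H n'] else 0.

Lemma dvd_XnP (p : {poly C}) n :
  reflect (forall i, (i < n)%N -> p`_i = 0) ('X^n %| p).
Proof.
apply: (iffP idP) => [/Pdiv.Field.dvdpP [q ->] i ilt|p0].
  by rewrite coefMXn ilt.
rewrite -(poly_take_drop n p) dvdp_add ?dvdp_mull//.
suff -> : take_poly n p = 0 by rewrite dvdp0.
apply/polyP => i; rewrite coef_take_poly coef0; case: ifP => // /p0 //.
Qed.

(** The difference gains one power of X: in the linear term from H_1, whose constant term vanishes,
    and in degree j >= 2 from the cofactor of S - T in S^j - T^j, all of whose summands are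
    multiples of X. *)
Lemma horner_sub_dvd (H : {poly {poly C}}) (S T : {poly C}) n :
  H`_1`_0 = 0 -> 'X %| S -> 'X %| T -> 'X^n %| S - T ->
  'X^(n.+1) %| H.[S] - H.[T].
Proof.
move=> H10 XS XT XST; rewrite !horner_coef -sumrB.
apply: (big_ind (fun p : {poly C} => 'X^(n.+1) %| p)) => [|p q|[[|[|j]] jH] _] /=.
- exact: dvdp0.
- exact: dvdp_add.
- by rewrite subrr dvdp0.
- rewrite -mulrBr !expr1 exprS dvdp_mul//.
  by apply/(dvd_XnP _ 1) => -[].
- rewrite -mulrBr dvdp_mull// subrXX mulrC exprS dvdp_mul//.
  apply: (big_ind (fun p : {poly C} => 'X %| p)) => [|p q|i _]; first exact: dvdp0.
    exact: dvdp_add.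
  case: (posnP i) => [->|i0]; first by rewrite dvdp_mulr// subn0 exprS dvdp_mulr.
  by rewrite dvdp_mull// -(prednK i0) exprS dvdp_mulr.
Qed.

Lemma horner2 (G : {poly {poly C}}) (Y : {poly C}) w :
  G.[Y].[w] = G.[(Y.[w])%:P].[w].
Proof.
rewrite [G.[Y]]horner_coef [G.[_%:P]]horner_coef !horner_sum; apply: eq_bigr => j _.
by rewrite !hornerM !horner_exp hornerC.
Qed.

Lemma dvd_Xn_sub_take (p : {poly C}) n m : (m <= n)%N ->
  'X^m %| p - take_poly n p.
Proof.
move=> mn; apply/dvd_XnP => i im.
by rewrite coefB coef_take_poly (leq_trans im)// subrr.
Qed.

Section Picard.
Variable H : {poly {poly C}}.
Hypotheses (H00 : H`_0`_0 = 0) (H10 : H`_1`_0 = 0).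
Let T := picard H.

Lemma dvd_X_picard n : 'X %| T n.
Proof.
elim: n => [|n /(dvd_XnP _ 1) IHn]; first exact: dvdp0.
apply/(dvd_XnP _ 1) => -[_|//]; rewrite coef_take_poly/=.
by rewrite -/T -horner_coef0 horner2 (horner_coef0 (T n)) IHn// !horner_coef0.
Qed.

Lemma picard_step n : 'X^n %| T n.+1 - T n.
Proof.
elim: n => [|n IHn]; first by rewrite expr0 dvd1p.
have -> : T n.+2 - T n.+1 = (H.[T n.+1] - H.[T n])
  - (H.[T n.+1] - take_poly n.+2 H.[T n.+1]) + (H.[T n] - T n.+1).
  by rewrite /T [picard H n.+2]/=; ring.
rewrite dvdp_add ?dvd_Xn_sub_take// dvdp_sub ?dvd_Xn_sub_take//.
by rewrite horner_sub_dvd ?dvd_X_picard.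
Qed.

Lemma picard_eq n : 'X^n %| T n - H.[T n].
Proof.
have -> : T n - H.[T n] = - (T n.+1 - T n) - (H.[T n] - T n.+1) by ring.
by rewrite dvdp_sub ?dvdpNr ?picard_step ?dvd_Xn_sub_take.
Qed.

(** By [picard_step] the coefficient of degree i no longer changes from iterate i + 1 on, so all
    iterates are truncations of a single power series. *)
Lemma picard_poly n : T n = \poly_(i < n) (T i.+1)`_i.
Proof.
elim: n => [|n IHn]; first by rewrite poly_def big_ord0.
apply/polyP => i; rewrite coef_poly; case: ltnP => [|ni]; last first.
  by rewrite /T/= coef_take_poly ltnNge ni.
rewrite ltnS leq_eqVlt => /predU1P[->//|ilt].
have /dvd_XnP/(_ _ ilt)/eqP := picard_step n.
by rewrite coefB subr_eq0 => /eqP ->; rewrite [in LHS]IHn coef_poly ilt.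
Qed.

Lemma wnorm_picard r rho n : 0 <= r -> 0 <= rho ->
  \sum_(j < size H) wnorm r H`_j * rho ^+ j <= rho -> wnorm r (T n) <= rho.
Proof.
move=> r0 rho0 Hrho; elim: n => [|n IHn]; first by rewrite wnormC normr0.
rewrite (le_trans (wnorm_take _ _ r0))//.
by rewrite (le_trans (wnorm_horner _ r0 IHn)).
Qed.

End Picard.

Lemma implicit_series (G : {poly {poly C}}) (y0 : C) :
  G.[y0%:P].[0] = 0 -> G^`().[y0%:P].[0] != 0 ->
  exists (c : nat -> C) (r K : C), [/\ 0 < r, c 0%N = y0,
    forall N, 'X^N %| G.[\poly_(i < N) c i] &
    forall N, wnorm r (\poly_(i < N) c i) <= K].
Proof.
move=> G0; set g := _.[0] => g0.
(* Newton's map with the derivative frozen at the base point: a fixed point T of H gives the zero y0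
   + T of G, and dividing by g makes the linear coefficient of H vanish at 0. *)
pose H := 'X - (g^-1)%:P%:P * (G \Po ('X + y0%:P%:P)).
have HE (T : {poly C}) : H.[T] = T - g^-1 *: G.[y0%:P + T].
  by rewrite !hornerE horner_comp !hornerE -mul_polyC [T + y0%:P]addrC.
have H00 : H`_0`_0 = 0.
  by rewrite -!horner_coef0 HE sub0r addr0 hornerN hornerZ G0 mulr0 oppr0.
have H10 : H`_1`_0 = 0.
  have -> : H`_1 = H^`().[0] by rewrite horner_coef0 coef_deriv mulr1n.
  rewrite derivB derivX derivM derivC mul0r add0r deriv_comp derivD derivX derivC.
  rewrite addr0 mulr1 !hornerE horner_comp !hornerE ?add0r -horner_coef0 !hornerE.
  by rewrite -/g mulVf ?subrr.
have [r [rho [r0 rho0 Hrho]]] := contraction_radius H00 H10.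
pose T := picard H; pose c i := if i is 0%N then y0 else (T i.+1)`_i.
have TE N : (0 < N)%N -> \poly_(i < N) c i = y0%:P + T N.
  move=> N0; apply/polyP => i; rewrite coefD coefC
    [T N](picard_poly H00 H10) 2!coef_poly.
  case: i => [|i] /=; last by rewrite add0r.
  rewrite N0.
  by have /(dvd_XnP _ 1) -> := dvd_X_picard H00 1; rewrite ?addr0.
exists c, r, (`|y0| + rho); split=> // [] [|N].
- by rewrite expr0 dvd1p.
- have -> : G.[\poly_(i < N.+1) c i] = g%:P * (T N.+1 - H.[T N.+1]).
    by rewrite HE TE// opprB addrCA subrr addr0 -mul_polyC mulrA -polyCM mulfV// mul1r.
  by rewrite dvdp_mull// picard_eq.
- by rewrite poly_def big_ord0 wnormC normr0 addr_ge0 ?normr_ge0 ?ltW.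
- rewrite TE// (le_trans (wnormD _ _ (ltW r0)))// wnormC lerD2l.
  exact: wnorm_picard (ltW r0) (ltW rho0) Hrho.
Qed.

End Implicit.

(** * Convergence over R[i] *)

Section ComplexSeries.
Variable R : realType.
Local Notation C := (Cplx R).

Lemma normC_gt0E (e : C) : 0 < e -> exists2 x : R, 0 < x & e = x%:C.
Proof.
case: e => a b; rewrite ltcE/= => /andP[/eqP -> a0]; by exists a.
Qed.

Lemma expr_half_lt (e : C) : 0 < e -> \forall N \near \oo, 2^-1 ^+ N < e.
Proof.
move=> /normC_gt0E [x x0 ->].
have h1 : `|2^-1 : R| < 1.
  by rewrite ger0_norm ?invr_ge0 ?ler0n// invf_lt1 ?ltr0n// ltr1n.
have := cvg_expr h1; move=> /cvgrPdist_lt /(_ _ x0).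
apply: filterS => N; rewrite sub0r normrN ger0_norm ?exprn_ge0 ?invr_ge0 ?ler0n// => xN.
have -> : (2^-1 : C) = (2^-1 : R)%:C by rewrite fmorphV rmorph_nat.
by rewrite -rmorphXn ltcR.
Qed.

(** Completeness is used over R: the real and imaginary parts inherit absolute convergence from [a],
    and their limits are recombined. *)
Lemma abs_series_cvg (a : nat -> C) (K : C) :
  (forall N, \sum_(0 <= i < N) `|a i| <= K) ->
  exists l : C, (fun N => \sum_(0 <= i < N) a i) @ \oo --> l.
Proof.
move=> aK.
have ReK N : \sum_(0 <= i < N) `|complex.Re (a i)| <= complex.Re K.
  have := aK N; rewrite lecE => /andP[_]; apply: le_trans.
  rewrite raddf_sum; apply: ler_sum => i _.
  by have := normc_ge_Re (a i); rewrite lecE => /andP[].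
have ImK N : \sum_(0 <= i < N) `|complex.Im (a i)| <= complex.Re K.
  have := aK N; rewrite lecE => /andP[_]; apply: le_trans.
  rewrite raddf_sum; apply: ler_sum => i _.
  (* Multiplication by i turns the imaginary part into a real part up to sign, so the same bound
     applies. *)
  have := normc_ge_Re (a i * 'i%C); rewrite ReiNIm normrN normrM.
  have -> : `|'i%C : R[i]| = 1.
    by rewrite normc_def/= expr0n/= add0r expr1n sqrtr1.
  by rewrite mulr1 lecE => /andP[].
have cvgR (b : nat -> R) : (forall N, \sum_(0 <= i < N) `|b i| <= complex.Re K) ->
    cvgn (series b).
  move=> bK; apply: normed_cvg; apply: nondecreasing_is_cvgn.
    by apply/nondecreasing_seqP => N; rewrite /normed_series_of /series/=
      big_nat_recr//= lerDl.
  by exists (complex.Re K) => _ [N _ <-]; rewrite /normed_series_of /series/=.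
have /cvg_ex[/= x cx] := cvgR _ ReK; have /cvg_ex[/= y cy] := cvgR _ ImK.
pose l : C := x +i* y; exists l; apply/(@cvgrPdist_lt C C)
  => e /normC_gt0E [d d0 ->]; rewrite {}/l.
have d20 : 0 < d / 2 by rewrite divr_gt0.
have hx := (@cvgrPdist_lt R R _ _ _ _ _).1 cx _ d20.
have hy := (@cvgrPdist_lt R R _ _ _ _ _).1 cy _ d20.
near=> N.
have -> : \sum_(0 <= i < N) a i =
    (series (fun i => complex.Re (a i)) N) +i* (series (fun i => complex.Im (a i)) N).
  apply/eqP; rewrite eq_complex/= !raddf_sum/=.
  by apply/andP; split; apply/eqP.
have -> : (x +i* y) - ((series (fun i => complex.Re (a i)) N) +i*
    (series (fun i => complex.Im (a i)) N)) =
    (x - series (fun i => complex.Re (a i)) N)%:C +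
    'i%C * (y - series (fun i => complex.Im (a i)) N)%:C :> R[i].
  by rewrite [LHS]complexE.
apply: le_lt_trans (ler_normD _ _) _; rewrite normrM.
have -> : `|'i%C : R[i]| = 1.
  by rewrite normc_def/= expr0n/= add0r expr1n sqrtr1.
have nR (z : R) : `|z%:C| = `|z|%:C by rewrite normc_def/= expr0n/= addr0 sqrtr_sqr.
rewrite mul1r !nR (splitr d) [ltRHS]rmorphD/= ltrD ?ltcR//.
  by near: N; exact: hx.
by near: N; exact: hy.
Unshelve. all: by end_near.
Qed.

Lemma cvg_seqP (f : nat -> C) (l : C) : f @ \oo --> l <->
  forall e : C, 0 < e -> exists M, forall N, (M <= N)%N -> `|l - f N| < e.
Proof.
split=> [/(@cvgrPdist_lt C C) fl e /fl [M _ h]|fl].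
  by exists M => N MN; apply: h.
by apply/(@cvgrPdist_lt C C) => e /fl [M h]; exists M => // N; apply: h.
Qed.

Lemma norm_le_epsilon (x : C) : (forall e : C, 0 < e -> `|x| <= e) -> x = 0.
Proof.
move=> h; apply/eqP; rewrite -normr_le0 real_leNgt ?normr_real ?real0//.
apply/negP => x0; have /h : 0 < `|x| / 2 by rewrite divr_gt0.
by apply/negP; rewrite -real_ltNge ?gtr0_real ?divr_gt0// ltr_pdivrMr// ltr_pMr// ltr1n.
Qed.

Lemma lim_norm_le (a : nat -> C) (l K : C) :
  a @ \oo --> l -> (forall N, `|a N| <= K) -> `|l| <= K.
Proof.
move=> al aK; rewrite real_leNgt ?normr_real//; last first.
  by rewrite ger0_real// (le_trans _ (aK 0%N)).
apply/negP => Kl; have e0 : 0 < `|l| - K by rewrite subr_gt0.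
have [N /(_ N (leqnn N))] := (cvg_seqP a l).1 al _ e0.
apply/negP; rewrite -real_leNgt ?normr_real ?gtr0_real//.
by rewrite (le_trans _ (lerB_normD _ _))// ?opprK lerB// normrN.
Qed.

(** This is the shape of the epsilon-splittings below; a + 1 keeps the denominator positive when a =
    0. *)
Lemma half_bound (a e : C) : 0 <= a -> 0 <= e ->
  a * (e / (2 * (a + 1))) <= e / 2.
Proof.
move=> a0 e0; have a1 : 0 < a + 1 by rewrite ltr_wpDl.
have -> : a * (e / (2 * (a + 1))) = e / 2 * (a / (a + 1)) by rewrite invfM; ring.
by rewrite ler_piMr ?divr_ge0// ler_pdivrMr// mul1r lerDl.
Qed.

Lemma poly_lipschitz (P : {poly C}) (D : C) : 0 < D ->
  exists2 M : C, 0 <= M &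
    forall a b, `|a| <= D -> `|b| <= D -> `|P.[a] - P.[b]| <= M * `|a - b|.
Proof.
move=> D0; elim/poly_ind: P => [|P c [M M0 PM]].
  by exists 0 => // a b _ _; rewrite !horner0 subrr normr0 mul0r.
exists (M * D + wnorm D P) => [|a b aD bD].
  by rewrite addr_ge0 ?mulr_ge0 ?wnorm_ge0// ltW.
have -> : (P * 'X + c%:P).[a] - (P * 'X + c%:P).[b] =
    (P.[a] - P.[b]) * a + P.[b] * (a - b) by rewrite !hornerE; ring.
rewrite (le_trans (ler_normD _ _))// [leRHS]mulrDl lerD// normrM.
  by rewrite mulrAC ler_pM ?normr_ge0// PM.
rewrite ler_wpM2r ?normr_ge0//.
have := @norm_horner_le_wnorm _ D P b 0 D0.
by rewrite expr0 dvd1p expr0 mul1r; apply.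
Qed.

Lemma polyE_nat (c : nat -> C) N w :
  (\poly_(i < N) c i).[w] = \sum_(0 <= i < N) c i * w ^+ i.
Proof. by rewrite horner_poly big_mkord. Qed.

Lemma wnorm_polyE (r : C) (c : nat -> C) N :
  wnorm r (\poly_(i < N) c i) = \sum_(0 <= i < N) `|c i| * r ^+ i.
Proof.
rewrite (wnorm_wide r (size_poly N c)) big_mkord.
by apply: eq_bigr => i _; rewrite coef_poly ltn_ord.
Qed.

Lemma implicit_function (G : {poly {poly C}}) (y0 : C) :
  G.[y0%:P].[0] = 0 -> G^`().[y0%:P].[0] != 0 ->
  exists (c : nat -> C) (y : C -> C) (L rho : C),
    [/\ c 0%N = y0, forall N, 'X^N %| G.[\poly_(i < N) c i], 0 < rho, 0 <= L &
     forall w, `|w| <= rho ->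
       [/\ (fun N => \sum_(0 <= i < N) c i * w ^+ i) @ \oo --> y w,
           G.[(y w)%:P].[w] = 0 & `|y w - y0| <= L * `|w|]].
Proof.
move=> G0 G1; have [c [r [K [r0 c0 cX cK]]]] := implicit_series G0 G1.
(* Half the radius makes (|w| / r)^N at most 2^-N, which drives the residual of the partial sums to
   0. *)
pose rho : C := r / 2.
have rho0 : 0 < rho by rewrite divr_gt0.
have rhor : rho <= r by rewrite ler_pdivrMr// ler_peMr// ?ler1n// ltW.
have absK w N : `|w| <= rho -> \sum_(0 <= i < N) `|c i * w ^+ i| <= K.
  move=> wrho; apply: le_trans (cK N); rewrite wnorm_polyE.
  apply: ler_sum => i _; rewrite normrM normrX ler_wpM2l//.
  by rewrite lerXn2r ?nnegrE ?(ltW r0)// (le_trans wrho).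
pose S w N := \sum_(0 <= i < N) c i * w ^+ i.
(* Outside the disc an arbitrary value makes [y] total, as [choice] requires. *)
have exy w : exists l : C, `|w| <= rho -> S w @ \oo --> l.
  have [wr|/negP wr] := boolP (`|w| <= rho); last by exists 0.
  by have [l hl] := abs_series_cvg (absK w ^~ wr); exists l.
have {exy} [y hy] := choice exy.
have K0 : 0 <= K by rewrite (le_trans _ (cK 0%N))// wnorm_ge0// ltW.
exists c, y, (K / rho), rho; split=> //; first by rewrite divr_ge0 // ltW.
move=> w wr; split; first exact: hy.
(* G(w, y w) is compared with its value at a partial sum: the difference is small because G(w, .) is
   Lipschitz on a ball, and the value itself comes from a multiple of X^N whose weighted norm is at
   most W. *)
- pose Gw := map_poly (horner_eval w) G.
  have GwE t : G.[t%:P].[w] = Gw.[t].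
    by rewrite -[t in RHS](hornerC t w) -[_.[w]]/(horner_eval w _) -horner_map.
  have K10 : 0 < K + 1 by rewrite ltr_wpDl.
  have [M M0 HM] := poly_lipschitz Gw K10.
  have SK N : `|S w N| <= K.
    by rewrite (le_trans (ler_norm_sum _ _ _))// absK.
  have K1 : K <= K + 1 by rewrite lerDl.
  have yK : `|y w| <= K + 1 by rewrite (le_trans (lim_norm_le (hy w wr) SK)).
  rewrite GwE; apply: norm_le_epsilon => e e0.
  pose W := \sum_(j < size G) wnorm r G`_j * K ^+ j.
  have W0 : 0 <= W.
    by apply: sumr_ge0 => j _; rewrite mulr_ge0 ?exprn_ge0 ?wnorm_ge0// ltW.
  have e1 : 0 < e / (2 * (M + 1)) by rewrite divr_gt0// mulr_gt0// ltr_wpDl.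
  have e2 : 0 < e / (2 * (W + 1)) by rewrite divr_gt0// mulr_gt0// ltr_wpDl.
  have [N1 h1] := (cvg_seqP _ _).1 (hy w wr) _ e1.
  have [N2 _ h2] := expr_half_lt e2.
  pose N := maxn N1 N2.
  have {}h1 := h1 N (leq_maxl _ _).
  have {}h2 : 2^-1 ^+ N < e / (2 * (W + 1)) := h2 N (leq_maxr _ _).
  rewrite -(subrK Gw.[S w N] Gw.[y w]) (le_trans (ler_normD _ _))//.
  rewrite (splitr e) lerD//.
    rewrite (le_trans (HM _ _ yK (le_trans (SK N) K1)))//.
    rewrite (le_trans (ler_wpM2l M0 (ltW h1)))//.
    by rewrite half_bound ?(ltW e0).
  have -> : Gw.[S w N] = G.[\poly_(i < N) c i].[w].
    by rewrite (horner2 G) GwE (polyE_nat c).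
  have wler : `|w| <= r by rewrite (le_trans wr).
  rewrite (le_trans (norm_horner_le_wnorm r0 (cX N) wler))//.
  have wr2 : (`|w| / r) ^+ N <= 2^-1 ^+ N.
    rewrite lerXn2r ?nnegrE ?divr_ge0 ?(ltW r0) ?invr_ge0//.
    by rewrite ler_pdivrMr// mulrC.
  have GW : wnorm r G.[\poly_(i < N) c i] <= W by apply: wnorm_horner (ltW r0) _.
  rewrite (le_trans (ler_pM _ _ wr2 GW)) ?(wnorm_ge0 _ (ltW r0))
    ?exprn_ge0 ?divr_ge0 ?(ltW r0)//.
  by rewrite mulrC (le_trans (ler_wpM2l W0 (ltW h2)))//; exact: half_bound W0 (ltW e0).
(* Removing the constant term y0 from the partial sums leaves powers |w|^(i+1) <= (|w| / rho)
   rho^(i+1), whence the factor K / rho. *)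
- have -> : `|y w - y0| = `|y w - S w 0%N - y0| by rewrite /S big_nil subr0.
  rewrite /S big_nil subr0.
  apply: (@lim_norm_le (fun N => S w N.+1 - y0)) => [|N].
    apply/cvg_seqP => e /((cvg_seqP _ _).1 (hy w wr)) [M h]; exists M => N MN.
    by rewrite opprB addrA subrK h// leqW.
  rewrite /S big_nat_recl//= c0 mulr1 addrC addKr.
  rewrite (le_trans (ler_norm_sum _ _ _))//.
  have Krho : \sum_(0 <= i < N.+1) `|c i| * rho ^+ i <= K.
    apply: le_trans (cK N.+1); rewrite wnorm_polyE; apply: ler_sum => i _.
    by rewrite ler_wpM2l// lerXn2r ?nnegrE ?(ltW r0) ?(ltW rho0).
  rewrite mulrAC -mulrA (le_trans _ (ler_wpM2r _ Krho))
    ?divr_ge0 ?(ltW rho0) ?(ltW r0)//.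
  rewrite big_nat_recl//= mulrDl -[leLHS]add0r lerD//.
    by rewrite !mulr_ge0 ?invr_ge0 ?(ltW rho0).
  rewrite mulr_suml; apply: ler_sum => i _; rewrite normrM -mulrA ler_wpM2l//.
  have -> : rho ^+ i.+1 * (`|w| / rho) = `|w| * rho ^+ i.
    by rewrite exprS; field; rewrite gt_eqF.
  by rewrite normrX exprS ler_wpM2l// lerXn2r ?nnegrE ?(ltW rho0).
Qed.

End ComplexSeries.

(** * The polynomial p_uv and the characteristic polynomial of the update *)

Section RankOne.
Variable C : numFieldType.

(** In characteristic 0 the numbers 0, 1, ..., size p - 1 are distinct, which is one root too many
    for a nonzero p. *)
Lemma poly_eq0P (p : {poly C}) : (forall x, p.[x] = 0) -> p = 0.
Proof.
move=> p0; apply: contraTeq isT => pN0.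
have /(max_poly_roots pN0) : all (root p) [seq i%:R | i <- iota 0 (size p)].
  by apply/allP => x _; rewrite rootE p0.
rewrite map_inj_uniq ?iota_uniq; last by move=> i j /eqP; rewrite eqr_nat => /eqP.
by rewrite size_map size_iota ltnn => /(_ isT).
Qed.

(** Resolvent identities make sense only off the spectrum; with the characteristic polynomial for h
    they extend to polynomial identities. *)
Lemma poly_eq_off_roots (h p q : {poly C}) : h != 0 ->
  (forall x, h.[x] != 0 -> p.[x] = q.[x]) -> p = q.
Proof.
move=> h0 pq; apply/eqP; rewrite -subr_eq0 -(mulrI_eq0 _ (mulfI h0)).
apply/eqP/poly_eq0P => x; rewrite hornerM hornerD hornerN.
by have [->|/pq ->] := eqVneq h.[x] 0; rewrite ?mul0r// subrr mulr0.
Qed.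

(** The block matrix with rows (1, x) and (y, 1) factors into block triangular matrices in two
    ways. *)
Lemma det_1_sub_rank1 n (x : 'cV[C]_n) (y : 'rV[C]_n) :
  \det (1%:M - x *m y) = 1 - (y *m x) 0 0.
Proof.
have E1 : block_mx 1%:M x y (1%:M : 'M_1) =
    block_mx 1%:M 0 y 1%:M *m block_mx 1%:M x 0 (1%:M - y *m x).
  by rewrite mulmx_block !(mulmx0, mul0mx, mul1mx, mulmx1, addr0, add0r) addrC subrK.
have E2 : block_mx 1%:M x y (1%:M : 'M_1) =
    block_mx (1%:M - x *m y) x 0 1%:M *m block_mx 1%:M 0 y 1%:M.
  by rewrite mulmx_block !(mulmx0, mul0mx, mul1mx, mulmx1, addr0, add0r) subrK.
have := congr1 determinant E1; rewrite E2 !det_mulmx !det_lblock !det_ublock.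
by rewrite !det1 !mulr1 !mul1r => ->; rewrite det_mx11 !mxE.
Qed.

Variable n : nat.
Implicit Types (A M : 'M[C]_n.+1) (u v : 'cV[C]_n.+1) (w : 'rV[C]_n.+1).

Lemma horner_char_poly A x : (char_poly A).[x] = \det (x%:M - A).
Proof.
rewrite -[LHS]/(horner_eval x _) /char_poly -det_map_mx; congr (\det _).
apply/matrixP => i j; rewrite !mxE -[LHS]/(_.[x]) hornerD hornerN.
by rewrite hornerMn hornerX hornerC.
Qed.

Lemma unit_char_poly A x : (x%:M - A \is a GRing.unit) = ((char_poly A).[x] != 0).
Proof. by rewrite horner_char_poly -unitfE -unitmxE. Qed.

Definition mform w u M : C := (w *m M *m u) 0 0.

Lemma mformD w u M N : mform w u (M + N) = mform w u M + mform w u N.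
Proof. by rewrite /mform mulmxDr mulmxDl mxE. Qed.

Lemma mformZ w u a M : mform w u (a *: M) = a * mform w u M.
Proof. by rewrite /mform -scalemxAr -scalemxAl mxE. Qed.

Lemma mform_sum w u m (F : 'I_m -> 'M_n.+1) :
  mform w u (\sum_i F i) = \sum_i mform w u (F i).
Proof. by rewrite /mform mulmx_sumr mulmx_suml summxE. Qed.

Lemma mformM w u M N : mform w u (M * N) = mform (w *m M) u N.
Proof. by rewrite /mform -[M * N]/(M *m N) mulmxA. Qed.

(* The coefficients of (m(x) - m(A)) / (x - A), which is m(x) (x - A)^-1 since
   m(A) = 0. *)
Definition puv A w u : {poly C} :=
  \sum_(i < size (mxminpoly A)) \sum_(j < i)
    ((mxminpoly A)`_i * mform w u (A ^+ j)) *: 'X^(i.-1 - j).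

Lemma scalar_subrXX A x i :
  x ^+ i *: 1%:M - A ^+ i = (x%:M - A) * \sum_(j < i) x ^+ (i.-1 - j) *: A ^+ j.
Proof.
have xA : GRing.comm x%:M A by apply: comm_scalar_mx.
have xX k : x%:M ^+ k = (x ^+ k)%:M :> 'M_n.+1 by rewrite -rmorphXn.
rewrite scalemx1 -xX (subrXX_comm _ xA); congr (_ * _); apply: eq_bigr => j _.
by rewrite xX -mul_scalar_mx.
Qed.

Lemma minpoly_resolvent A x :
  (mxminpoly A).[x] *: 1%:M = (x%:M - A) *
    \sum_(i < size (mxminpoly A)) (mxminpoly A)`_i *:
      \sum_(j < i) x ^+ (i.-1 - j) *: A ^+ j.
Proof.
rewrite -[LHS]subr0 -[X in _ - X = _](mx_root_minpoly A)
  -{2}(coefK (mxminpoly A)) poly_def.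
rewrite rmorph_sum horner_coef scaler_suml -sumrB mulr_sumr.
apply: eq_bigr => i _; rewrite -mul_polyC rmorphM rmorphXn/= horner_mx_C horner_mx_X.
by rewrite -[_%:M * _]/(_ *m _) mul_scalar_mx -scalerA -scalerBr scalar_subrXX scalerAr.
Qed.

Lemma horner_puv A w u x : x%:M - A \is a GRing.unit ->
  (puv A w u).[x] = mform w u ((mxminpoly A).[x] *: (x%:M - A)^-1).
Proof.
move=> xA; set T := \sum_(i < size (mxminpoly A)) (mxminpoly A)`_i *:
      \sum_(j < i) x ^+ (i.-1 - j) *: A ^+ j.
have -> : (mxminpoly A).[x] *: (x%:M - A)^-1 = T.
  rewrite -[RHS](mulKr xA) -minpoly_resolvent -scalerAr.
  by rewrite -[_^-1 * _]/(_ *m _) mulmx1.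
rewrite mform_sum horner_sum; apply: eq_bigr => i _.
rewrite mformZ mform_sum mulr_sumr horner_sum; apply: eq_bigr => j _.
by rewrite mformZ hornerZ hornerXn -mulrA [_ * x ^+ _]mulrC.
Qed.

Lemma puv_unique A w u p :
  (forall x, x%:M - A \is a GRing.unit ->
    p.[x] = mform w u ((mxminpoly A).[x] *: (x%:M - A)^-1)) -> p = puv A w u.
Proof.
move=> pE; apply: (@poly_eq_off_roots (char_poly A)) => [|x].
  exact: monic_neq0 (char_poly_monic A).
by rewrite -unit_char_poly => xA; rewrite pE// horner_puv.
Qed.

Lemma size_puv A w u : (size (puv A w u) <= degree_mxminpoly A)%N.
Proof.
apply: leq_trans (size_sum _ _ _) _; apply/bigmax_leqP => i _.
apply: leq_trans (size_sum _ _ _) _; apply/bigmax_leqP => j _.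
rewrite (leq_trans (size_scale_leq _ _))// size_polyXn.
have il : (i <= degree_mxminpoly A)%N by rewrite -ltnS -(size_mxminpoly A).
apply: leq_trans il; rewrite (leq_ltn_trans (leq_subr _ _))// ltn_predL.
exact: leq_ltn_trans (ltn_ord j).
Qed.

(** Divided by m, this is the finite Neumann expansion of the resolvent at infinity, x^J (x - A)^-1
    = sum_(j < J) x^(J-1-j) A^j + A^J (x - A)^-1. The remainder is again of the form [puv], with w
    A^J in place of w. *)
Lemma puv_moments A w u J :
  'X^J * puv A w u =
  mxminpoly A * (\sum_(j < J) mform w u (A ^+ j) *: 'X^(J.-1 - j))
  + puv A (w *m A ^+ J) u.
Proof.
apply: (@poly_eq_off_roots (char_poly A)) => [|x].
  exact: monic_neq0 (char_poly_monic A).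
rewrite -unit_char_poly => xA.
rewrite hornerD !hornerM !horner_puv// horner_sum hornerXn.
rewrite -mformM -scalerAr !mformZ mulrCA -mulrDr; congr (_ * _).
rewrite -mformZ.
have -> : x ^+ J *: (x%:M - A)^-1 =
    \sum_(j < J) x ^+ (J.-1 - j) *: A ^+ j + A ^+ J * (x%:M - A)^-1.
  have Ax : A ^+ J * (x%:M - A)^-1 = (x%:M - A)^-1 * A ^+ J.
    apply: commrV; apply/commr_sym/commrX; apply/commr_sym.
    by apply: commrB => //; apply: comm_mx_scalar.
  rewrite -[X in _ = X + _](mulKr xA) -scalar_subrXX mulrBr Ax subrK -scalerAr.
  by rewrite -[_^-1 * _]/(_ *m _) mulmx1.
rewrite mformD mform_sum; congr (_ + _); apply: eq_bigr => j _.
by rewrite mformZ hornerZ hornerXn mulrC.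
Qed.

(** The counterpart at a point z off the spectrum: with N = z - A, iterating the resolvent identity
    L = N^-1 + (z - x) N^-1 L expands L = (x - A)^-1 in powers of z - x. *)
Lemma puv_resolvents A w u z J : z%:M - A \is a GRing.unit ->
  puv A w u =
  mxminpoly A * (\sum_(j < J) mform w u ((z%:M - A) ^- j.+1) *: (z%:P - 'X) ^+ j)
  + (z%:P - 'X) ^+ J * puv A (w *m (z%:M - A) ^- J) u.
Proof.
move=> zA; apply: (@poly_eq_off_roots (char_poly A)) => [|x].
  exact: monic_neq0 (char_poly_monic A).
rewrite -unit_char_poly => xA.
rewrite hornerD !hornerM !horner_puv// horner_sum horner_exp.
have zx : (z%:P - 'X).[x] = z - x by rewrite !hornerE.
rewrite zx.
rewrite -mformM -scalerAr !mformZ [X in _ = _ + X]mulrCA -mulrDr; congr (_ * _).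
rewrite -mformZ.
set N := z%:M - A; set L := (x%:M - A)^-1.
have LE : L = N^-1 + (z - x) *: (N^-1 * L).
  have NE : N = (x%:M - A) + (z - x)%:M.
    by rewrite [RHS]addrAC -raddfD/= [x + _]addrC subrK.
  rewrite -[LHS](mulKr zA) -/N {2}NE mulrDl mulrV// mulrDr mulr1.
  by rewrite -[_%:M * L]/(_ *m _) mul_scalar_mx scalerAr.
have {1}-> : L = \sum_(j < J) (z - x) ^+ j *: N ^- j.+1 + (z - x) ^+ J *: (N ^- J * L).
  elim: J => [|J IHJ]; first by rewrite big_ord0 add0r !expr0 invr1 mul1r scale1r.
  rewrite {1}IHJ big_ord_recr/= -addrA; congr (_ + _).
  rewrite {1}LE mulrDr scalerDr -scalerAr scalerA -exprSr mulrA.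
  by rewrite -!exprVn -exprSr.
rewrite mformD mform_sum; congr (_ + _); apply: eq_bigr => j _.
by rewrite mformZ hornerZ horner_exp zx mulrC.
Qed.

End RankOne.

Section Update.
Variables (C : numClosedFieldType) (n : nat).
Implicit Types (A M : 'M[C]_n.+1) (u v : 'cV[C]_n.+1).

Lemma char_poly_update A u v tau :
  mxminpoly A * char_poly (rank_one_update A u v tau) =
  char_poly A * (mxminpoly A - tau *: puv A (v ^t*) u).
Proof.
apply: (@poly_eq_off_roots _ (char_poly A)) => [|x].
  exact: monic_neq0 (char_poly_monic A).
rewrite -unit_char_poly => xA.
rewrite !hornerM [(_ - _ *: _).[x]]hornerD hornerN hornerZ horner_puv//.
rewrite !horner_char_poly.
have -> : x%:M - rank_one_update A u v tau =
    (x%:M - A) *m (1%:M - ((x%:M - A)^-1 *m (tau *: u)) *m v ^t*).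
  rewrite mulmxBr mulmx1 !mulmxA -[_ *m _^-1]/(_ * _) mulrV// mul1mx.
  by rewrite -scalemxAl /rank_one_update opprD addrA.
rewrite det_mulmx det_1_sub_rank1 mulmxA -scalemxAr mxE.
by rewrite mformZ /mform; ring.
Qed.

(** Since m divides [char_poly A], cancelling m in [char_poly_update] exhibits m - tau p as a factor
    of the updated characteristic polynomial. *)
Lemma dvd_char_poly_update A u v tau d :
  d %| mxminpoly A - tau *: puv A (v ^t*) u ->
  d %| char_poly (rank_one_update A u v tau).
Proof.
move=> dq; have /Pdiv.Field.dvdpP[h hE] := mxminpoly_dvd_char A.
have m0 : mxminpoly A != 0 by apply: monic_neq0 (mxminpoly_monic A).
have := char_poly_update A u v tau.
rewrite hE [h * _]mulrC -mulrA => /(mulfI m0) ->.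
by rewrite dvdp_mull.
Qed.

End Update.

(** * Branches at a finite root and at infinity *)

(** The powers of th sum to 0, so k is the sum of the 1 - th^i over i < k, and each of these has
    norm at most k |1 - th|. *)
Lemma unity_root_gap (F : numFieldType) (k : nat) (th : F) :
  (0 < k)%N -> th ^+ k = 1 -> th != 1 -> 1 <= k%:R * `|1 - th|.
Proof.
move=> k0 thk th1; have nth1 : `|th| = 1.
  by apply/eqP; rewrite -(pexpr_eq1 k0)// -normrX thk normr1.
have s0 : \sum_(i < k) th ^+ i = 0.
  have := subrX1 th k; rewrite thk subrr => /esym/eqP.
  by rewrite mulf_eq0 subr_eq0 (negbTE th1) => /eqP.
have pw i : `|1 - th ^+ i| <= i%:R * `|1 - th|.
  elim: i => [|i IHi]; first by rewrite expr0 subrr normr0 mul0r.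
  have -> : 1 - th ^+ i.+1 = (1 - th ^+ i) + th ^+ i * (1 - th).
    by rewrite exprSr; ring.
  rewrite (le_trans (ler_normD _ _))// -natr1 mulrDl mul1r lerD//.
  by rewrite normrM normrX nth1 expr1n mul1r.
have kR : (0 : F) < k%:R by rewrite ltr0n.
rewrite -(ler_pM2l kR) mulr1.
have {1}-> : (k%:R : F) = `|\sum_(i < k) (1 - th ^+ i)|.
  by rewrite sumrB s0 subr0 sumr_const card_ord normr_nat.
rewrite (le_trans (ler_norm_sum _ _ _))//.
have -> : k%:R * (k%:R * `|1 - th|) = \sum_(i < k) k%:R * `|1 - th|.
  by rewrite sumr_const card_ord -[RHS]mulr_natl.
apply: ler_sum => i _; rewrite (le_trans (pw i))// ler_wpM2r// ler_nat.
exact: ltnW.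
Qed.

(** Half the harmonic mean replaces a minimum and avoids comparing a with b in the partial order of
    F. *)
Lemma pos_lower_bound (F : numFieldType) (a b : F) : 0 < a -> 0 < b ->
  exists c : F, [/\ 0 < c, c <= a & c <= b].
Proof.
move=> a0 b0; have ab : 0 < a + b by rewrite addr_gt0.
exists (a * b / (a + b)); split; first by rewrite divr_gt0// mulr_gt0.
  by rewrite ler_pdivrMr// ler_pM2l// lerDr ltW.
by rewrite ler_pdivrMr// mulrC ler_pM2l// lerDl ltW.
Qed.

(* Distinct k-th roots w of the same number give distinct branch values: an
   equality between two values would read y w = th * y w'. *)
Lemma unity_root_rigidity (F : numFieldType) (y : F -> F) (y0 L rho : F) k :
  (0 < k)%N -> y0 != 0 -> 0 < rho -> 0 <= L ->
  (forall w, `|w| <= rho -> `|y w - y0| <= L * `|w|) ->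
  exists eta : F, [/\ 0 < eta, eta <= rho &
    forall w w' th, `|w| <= eta -> `|w'| <= eta -> th ^+ k = 1 ->
      y w = th * y w' -> th = 1].
Proof.
move=> k0 y00 rho0 L0 yL.
have kR : (0 : F) < k%:R by rewrite ltr0n.
(* The gap lemma gives |y0| <= k |y0 (1 - th)|, whereas y w = th y w' bounds |y0 (1 - th)| by 2 L
   eta. Since 3 (L + 1) > 2 L, also for L = 0, this radius makes the two bounds incompatible. *)
have d0 : 0 < `|y0| / (k%:R * (3 * (L + 1))).
  by rewrite divr_gt0 ?normr_gt0// !mulr_gt0// ltr_wpDl.
have [eta [eta0 etarho etad]] := pos_lower_bound rho0 d0.
exists eta; split=> // w w' th weta w'eta thk yth; apply/eqP/negPn/negP => th1.
have nth1 : `|th| = 1.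
  by apply/eqP; rewrite -(pexpr_eq1 k0)// -normrX thk normr1.
have := unity_root_gap k0 thk th1.
have y0gt : 0 < `|y0| by rewrite normr_gt0.
rewrite -(ler_pM2l y0gt) mulr1 mulrCA -normrM; apply/negP.
have -> : y0 * (1 - th) = th * (y w' - y0) - (y w - y0) by rewrite yth; ring.
rewrite -real_ltNge ?normr_real ?realM ?normr_real ?realn//.
rewrite mulrC -ltr_pdivlMr// (le_lt_trans (ler_normB _ _))// normrM nth1 mul1r.
have Leta v : `|v| <= eta -> `|y v - y0| <= L * eta.
  by move=> veta; rewrite (le_trans (yL _ (le_trans veta etarho)))// ler_wpM2l.
rewrite (le_lt_trans (lerD (Leta _ w'eta) (Leta _ weta)))//.
rewrite -mulrDl (@lt_le_trans _ _ (3 * (L + 1) * eta))//.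
  rewrite ltr_pM2r// -subr_gt0.
  have -> : 3 * (L + 1) - (L + L) = L + 3 by ring.
  by rewrite ltr_wpDl.
rewrite (le_trans (ler_wpM2l _ etad)) ?mulr_ge0 ?addr_ge0//.
rewrite le_eqVlt; apply/orP; left; apply/eqP; field.
by rewrite gt_eqF//= gt_eqF// ltr_wpDl.
Qed.

Lemma kth_roots_exist (F : numClosedFieldType) (k : nat) (x : F) :
  (0 < k)%N -> x != 0 -> exists z : 'I_k -> F, distinct_kth_roots x z.
Proof.
move=> k0 x0; pose p : {poly F} := 'X^k - x%:P.
have pm : p \is monic by rewrite monicXnsubC.
have sp : size p = k.+1 by rewrite size_XnsubC.
have [rs pE] := closed_field_poly_normal p.
rewrite (monicP pm) scale1r in pE.
have srs : size rs = k by move: sp; rewrite pE size_prod_XsubC => -[].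
have urs : uniq rs.
  rewrite -separable_prod_XsubC -pE separable_poly.unlock; apply/Bezout_coprimepP.
  (* Separability, from the Bezout relation -(1/x) (X^k - x) + (X / (k x)) (k X^(k-1)) = 1. *)
  exists (- (x^-1)%:P, (x^-1 / k%:R)%:P * 'X) => /=.
  rewrite /p derivB derivXn derivC subr0.
  suff -> : - (x^-1)%:P * ('X^k - x%:P) + (x^-1 / k%:R)%:P * 'X * ('X^(k.-1) *+ k) = 1.
    exact: eqpxx.
  have Xk : 'X^k = 'X * 'X^(k.-1) :> {poly F} by rewrite -exprS prednK.
  rewrite -['X^_ *+ k]mulr_natl -polyC_natr Xk.
  have E1 : (x^-1 / k%:R)%:P * (k%:R)%:P = (x^-1)%:P.
    by rewrite -polyCM divfK// pnatr_eq0 -lt0n.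
  have E2 : (x^-1)%:P * x%:P = 1 by rewrite -polyCM mulVf.
  rewrite mulrACA E1 mulNr mulrBr E2 opprB -addrA [- _ + _]addrC subrr addr0 //.
exists (fun j => rs`_j); split=> [i j /eqP|j].
  by rewrite nth_uniq ?srs// => /eqP/val_inj.
have : root p rs`_j by rewrite pE root_prod_XsubC mem_nth// srs.
by rewrite rootE !hornerE subr_eq0 => /eqP.
Qed.

Section Puiseux.
Variable R : realType.
Local Notation C := (Cplx R).

(** For lambda = zeta - w Y the factor (zeta - lambda)^k equals w^k Y^k and cancels w^-k. What
    remains, M(zeta - w Y) - Y^k P1(zeta - w Y), is polynomial in w and has the simple root b1 at w
    = 0. *)
Lemma puiseux_finite (M P1 : {poly C}) (zeta b1 : C) k : (0 < k)%N ->
  M.[zeta] != 0 -> P1.[zeta] != 0 -> b1 ^+ k * P1.[zeta] = M.[zeta] ->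
  exists (c : nat -> C) (y : C -> C) (L eta : C),
  [/\ c 0%N = b1,
      forall N, (let Y := \poly_(i < N) c i in
        'X^N %| (M \Po (zeta%:P - 'X * Y)) - Y ^+ k * (P1 \Po (zeta%:P - 'X * Y))),
      0 < eta,
      forall w, `|w| <= eta ->
        (fun N => \sum_(0 <= i < N) c i * w ^+ i) @ \oo --> y w /\ `|y w| <= L
    & (forall w, `|w| <= eta -> w != 0 ->
        root (M - w ^- k *: ((zeta%:P - 'X) ^+ k * P1)) (zeta - w * y w)) /\
      (forall w w', `|w| <= eta -> `|w'| <= eta -> w != 0 -> w ^+ k = w' ^+ k ->
        w * y w = w' * y w' -> w = w')].
Proof.
move=> k0 M0 P10 b1k.
have b10 : b1 != 0.
  by apply: contraNneq M0 => b1E; rewrite -b1k b1E expr0n gtn_eqF// mul0r.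
(* The outer indeterminate stands for y and ['X%:P] for w. *)
pose Lam : {poly {poly C}} := zeta%:P%:P - 'X%:P * 'X.
pose cc (p : {poly C}) := map_poly polyC p.
pose G := (cc M \Po Lam) - 'X^k * (cc P1 \Po Lam).
have GE Y : G.[Y] = (M \Po (zeta%:P - 'X * Y)) - Y ^+ k * (P1 \Po (zeta%:P - 'X * Y)).
  rewrite /G hornerD hornerN hornerM hornerXn !horner_comp.
  by rewrite /Lam hornerD hornerN hornerC hornerM hornerC hornerX.
have LamE (y w : C) : (zeta%:P - 'X * y%:P).[w] = zeta - w * y.
  by rewrite !hornerE.
have GEw y w : G.[y%:P].[w] = M.[zeta - w * y] - y ^+ k * P1.[zeta - w * y].
  by rewrite GE hornerD hornerN hornerM horner_exp hornerC !horner_comp LamE.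
have G0 : G.[b1%:P].[0] = 0 by rewrite GEw mul0r subr0 b1k subrr.
have G1 : G^`().[b1%:P].[0] != 0.
  have LamD : Lam^`() = - 'X%:P.
    by rewrite /Lam derivB derivC derivM derivC derivX !(mul0r, add0r, mulr1).
  (* The chain-rule terms carry a factor w, so at w = 0 the derivative is - k b1^(k-1) P1(zeta). *)
  rewrite /G derivB derivM !deriv_comp LamD derivXn.
  rewrite !(hornerD, hornerN, hornerM, hornerC, hornerX,
    hornerMn, hornerXn, horner_exp).
  rewrite !(oppr0, mulr0, addr0, sub0r, oppr_eq0) horner_comp.
  rewrite /Lam !(hornerD, hornerN, hornerM, hornerC, hornerX).
  rewrite -[(cc P1).[_]]/(P1 \Po _) horner_comp
    !(hornerD, hornerN, hornerM, hornerC, hornerX).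
  rewrite mul0r subr0 mulf_neq0// mulrn_eq0 negb_or -lt0n k0/=.
  by rewrite expf_neq0.
have [c [y [L [rho [c0 cX rho0 L0 hy]]]]] := implicit_function G0 G1.
have yL w : `|w| <= rho -> `|y w - b1| <= L * `|w| by move=> /hy [].
have [eta [eta0 etarho rig]] := unity_root_rigidity k0 b10 rho0 L0 yL.
exists c, y, (`|b1| + L * rho), eta; split=> //.
- by move=> N /=; rewrite -GE.
- move=> w weta; have wrho := le_trans weta etarho.
  have [cy _ yw] := hy _ wrho; split=> //.
  rewrite -[y w](subrK b1) addrC (le_trans (ler_normD _ _))// lerD2l.
  by rewrite (le_trans yw)// ler_wpM2l.
split.
- move=> w weta w0; have [_ Gw _] := hy _ (le_trans weta etarho).
  rewrite rootE hornerD hornerN hornerZ hornerM horner_exp.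
  have -> : (zeta%:P - 'X).[zeta - w * y w] = w * y w by rewrite !hornerE; ring.
  rewrite exprMn !mulrA mulVf ?expf_neq0// mul1r.
  by rewrite -GEw Gw.
- move=> w w' weta w'eta w0 wk wy.
  have th1 : (w' / w) ^+ k = 1 by rewrite expr_div_n wk mulfV// -wk expf_neq0.
  have yth : y w = w' / w * y w' by rewrite mulrAC -wy mulrAC mulfV// mul1r.
  have := rig _ _ _ weta w'eta th1 yth; move=> /(congr1 ( *%R^~ w)).
  by rewrite divfK// mul1r.
Qed.

(* w^d p(y / w), as a polynomial in y whose coefficients are polynomials in
   w. *)
Definition hom d (p : {poly C}) : {poly {poly C}} :=
  \poly_(i < d.+1) (p`_i *: 'X^(d - i)).

Lemma horner_hom d (p Y : {poly C}) (w : C) : (size p <= d.+1)%N -> w != 0 ->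
  (hom d p).[Y].[w] = w ^+ d * p.[Y.[w] / w].
Proof.
move=> pd w0; rewrite horner_poly horner_sum (horner_coef_wide _ pd) mulr_sumr.
apply: eq_bigr => i _; rewrite hornerM hornerZ hornerXn horner_exp expr_div_n.
have -> : w ^+ d = w ^+ (d - i) * w ^+ i by rewrite -exprD subnK// -ltnS.
field.
by rewrite expf_neq0.
Qed.

Lemma hom_at0 d (p : {poly C}) : map_poly (horner_eval 0) (hom d p) = p`_d *: 'X^d.
Proof.
apply/polyP => i; rewrite coef_map coef_poly coefZ coefXn ltnS.
case: (ltngtP i d) => [id|id|->] /=; rewrite /horner_eval.
- by rewrite hornerZ hornerXn expr0n subn_eq0 leqNgt id !mulr0.
- by rewrite horner0 mulr0.
- by rewrite subnn expr0 hornerZ hornerC.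
Qed.

(** With lambda = y / w and tau = w^-K, multiplying m - tau p by w^l gives
    [hom l m - hom (l - K) p]. At w = 0 only top coefficients remain, namely y^(l-K) (y^K - s), of
    which c_m1 is a nonzero simple root. *)
Lemma puiseux_infinite (m p : {poly C}) l K (c_m1 : C) : (0 < K)%N -> (K <= l)%N ->
  (size m <= l.+1)%N -> m`_l = 1 -> (size p <= (l - K).+1)%N ->
  p`_(l - K) != 0 -> c_m1 ^+ K = p`_(l - K) ->
  exists (c : nat -> C) (y : C -> C) (eta : C),
  [/\ c 0%N = c_m1,
      forall N, 'X^N %| (hom l m - hom (l - K) p).[\poly_(i < N) c i],
      0 < eta,
      forall w, `|w| <= eta ->
        (fun N => \sum_(0 <= i < N) c i * w ^+ i) @ \oo --> y w
    & (forall w, `|w| <= eta -> w != 0 -> root (m - w ^- K *: p) (y w / w)) /\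
      (forall w w', `|w| <= eta -> `|w'| <= eta -> w != 0 -> w ^+ K = w' ^+ K ->
        y w / w = y w' / w' -> w = w')].
Proof.
move=> K0 Kl sm ml sp s0 cK; set s := p`_(l - K) in s0 cK.
have c0 : c_m1 != 0.
  by apply: contraNneq s0 => cE; rewrite -cK cE expr0n gtn_eqF.
pose G := hom l m - hom (l - K) p.
pose G0 := map_poly (horner_eval 0) G.
have G0E : G0 = 'X^(l - K) * ('X^K - s%:P).
  rewrite /G0 /G rmorphB/= !hom_at0 ml scale1r mulrBr -exprD subnK//.
  by rewrite mulrC mul_polyC.
have ev (H : {poly {poly C}}) (x : C) : H.[x%:P].[0] = (map_poly (horner_eval 0) H).[x].
  by rewrite -[x in RHS](hornerC x 0) -[_.[0]]/(horner_eval 0 _) -horner_map.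
have h0 : G.[c_m1%:P].[0] = 0.
  by rewrite ev -/G0 G0E hornerM hornerD hornerN hornerXn
    hornerC hornerXn cK subrr mulr0.
have h1 : G^`().[c_m1%:P].[0] != 0.
  rewrite ev -deriv_map -/G0 G0E derivM derivB derivC subr0 !derivXn.
  rewrite hornerD !hornerM hornerD hornerN hornerXn hornerC cK subrr mulr0 add0r.
  by rewrite hornerXn hornerMn hornerXn mulf_neq0 ?expf_neq0//
    mulrn_eq0 negb_or -lt0n K0 expf_neq0.
have [c [y [L [rho [cc0 cX rho0 L0 hy]]]]] := implicit_function h0 h1.
have yL w : `|w| <= rho -> `|y w - c_m1| <= L * `|w| by move=> /hy [].
have [eta [eta0 etarho rig]] := unity_root_rigidity K0 c0 rho0 L0 yL.
exists c, y, eta; split=> //.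
- by move=> w weta; have [] := hy _ (le_trans weta etarho).
split.
- move=> w weta w0; have [_ Gw _] := hy _ (le_trans weta etarho).
  move: Gw; rewrite /G hornerD hornerN hornerD hornerN !horner_hom// hornerC => Gw.
  rewrite rootE hornerD hornerN hornerZ -(mulrI_eq0 _ (mulfI (expf_neq0 l w0))).
  rewrite mulrBr mulrA -{2}(subnK Kl) exprD mulfK ?expf_neq0//.
  by rewrite Gw.
- move=> w w' weta w'eta w0 wk wy.
  have w'0 : w' != 0.
    by apply: contraNneq w0 => w'E; move: wk;
      rewrite w'E expr0n gtn_eqF// => /eqP; rewrite expf_eq0 => /andP[].
  have th1 : (w / w') ^+ K = 1 by rewrite expr_div_n wk mulfV// expf_neq0.
  have yth : y w = w / w' * y w' by rewrite mulrAC -mulrA -wy mulrC divfK.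
  have := rig _ _ _ weta w'eta th1 yth; move=> /(congr1 ( *%R^~ w')).
  by rewrite divfK// mul1r.
Qed.

End Puiseux.

(** * Families of eigenvalues *)

Section Families.
Variable C : numClosedFieldType.

Lemma card_pred_eq_count k (r : 'I_k -> C) x :
  #|[pred i | r i == x]| = count_mem x [seq r i | i <- enum 'I_k].
Proof.
rewrite -sum1_card -sum1_count big_map big_enum_cond/=.
by apply: eq_bigl => i; rewrite inE.
Qed.

Lemma prod_XsubC_enum k (r : 'I_k -> C) :
  \prod_i ('X - (r i)%:P) = \prod_(x <- [seq r i | i <- enum 'I_k]) ('X - x%:P).
Proof. by rewrite big_map big_enum. Qed.

Lemma mup_prod k (r : 'I_k -> C) x :
  mup x (\prod_i ('X - (r i)%:P)) = #|[pred i | r i == x]|.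
Proof. by rewrite prod_XsubC_enum mu_prod_XsubC card_pred_eq_count. Qed.

Lemma mup_dvd (p q : {poly C}) x : q != 0 -> p %| q -> (mup x p <= mup x q)%N.
Proof.
move=> q0 pq; have p0 : p != 0 by apply: contraNneq q0 => p0;
  move: pq; rewrite p0 dvd0p.
rewrite mup_geq//; apply: dvdp_trans pq.
by rewrite -mup_geq.
Qed.

Lemma eigenvalue_family_dvd n (M : 'M[C]_n.+1) k (lam : 'I_k -> C) :
  \prod_i ('X - (lam i)%:P) %| char_poly M -> eigenvalue_family M lam.
Proof.
move=> h x; rewrite -mup_prod mup_dvd//.
exact: monic_neq0 (char_poly_monic M).
Qed.

Lemma prod_distinct_dvd (q : {poly C}) k (lam : 'I_k -> C) : injective lam ->
  (forall i, root q (lam i)) -> \prod_i ('X - (lam i)%:P) %| q.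
Proof.
move=> inj rt; rewrite prod_XsubC_enum.
apply: uniq_roots_dvdp; first by apply/allP => _ /mapP[i _ ->].
by rewrite uniq_rootsE map_inj_uniq ?enum_uniq.
Qed.

(** The factorization is known only for large tau, while an eigenvalue family is required for all
    tau: elsewhere k arbitrary roots of the characteristic polynomial are taken. A single good tau
    shows that k <= n + 1. *)
Lemma extend_eigenvalue_family n (B : C -> 'M[C]_n.+1) k
    (Q : C -> ('I_k -> C) -> Prop) :
  (\forall tau \near infty_nbhs C, exists lam : 'I_k -> C,
     \prod_i ('X - (lam i)%:P) %| char_poly (B tau) /\ Q tau lam) ->
  exists lam : 'I_k -> C -> C,
    (forall tau, eigenvalue_family (B tau) (lam ^~ tau)) /\
    \forall tau \near infty_nbhs C, Q tau (lam ^~ tau).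
Proof.
move=> near_lam.
have kn : (k <= n.+1)%N.
  have [tau [lam [/dvdp_leq h _]]] := filter_ex near_lam.
  have := h (monic_neq0 (char_poly_monic _)).
  by rewrite size_char_poly size_prod_XsubC /index_enum -enumT size_enum_ord.
have dflt tau : exists lam : 'I_k -> C, \prod_i ('X - (lam i)%:P) %| char_poly (B tau).
  have [rs] := closed_field_poly_normal (char_poly (B tau)).
  rewrite (monicP (char_poly_monic _)) scale1r => rsE.
  have srs : size rs = n.+1.
    by have := size_char_poly (B tau); rewrite rsE size_prod_XsubC => -[].
  exists (fun i => rs`_i); rewrite rsE (big_nth 0) srs.
  rewrite -(big_mkord xpredT (fun i => 'X - (rs`_i)%:P)).
  by rewrite [X in _ %| X](@big_cat_nat _ _ _ k)//= dvdp_mulr.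
pose good tau lam := \prod_i ('X - (lam i)%:P) %| char_poly (B tau) /\ Q tau lam.
have all tau : exists lam : 'I_k -> C,
    \prod_i ('X - (lam i)%:P) %| char_poly (B tau) /\
    ((exists lam', good tau lam') -> Q tau lam).
  have [[lam [h1 h2]]|nex] := pselect (exists lam, good tau lam).
    by exists lam.
  by have [lam h] := dflt tau; exists lam.
have [lam hlam] := choice all.
exists (fun i tau => lam tau i); split=> [tau|].
  by apply: eigenvalue_family_dvd; have [] := hlam tau.
by apply: filterS near_lam => tau; have [_] := hlam tau; apply.
Qed.

Lemma near_infty_neq0 : \forall tau \near infty_nbhs C, tau != 0.
Proof.
by exists 0 => [|x]; rewrite ?real0// normr_gt0.
Qed.

Lemma near_infty_small_root k (eta : C) : (0 < k)%N -> 0 < eta ->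
  \forall tau \near infty_nbhs C, forall w, w ^+ k = tau^-1 -> `|w| <= eta.
Proof.
move=> k0 eta0; exists (eta ^- k) => [|tau tau_big w wk].
  by rewrite realV realX// gtr0_real.
have tau0 : 0 < `|tau| by rewrite (lt_trans _ tau_big)// invr_gt0 exprn_gt0.
rewrite -(ler_pXn2r k0) ?nnegrE ?(ltW eta0)// -normrX wk normfV.
by rewrite -lef_pV2 ?posrE ?invr_gt0 ?exprn_gt0// invrK ltW.
Qed.

Lemma tendsP (f : C -> C) l : tends_at_infty f l <->
  forall e, 0 < e -> \forall tau \near infty_nbhs C, `|l - f tau| < e.
Proof. exact: (@cvgrPdist_lt C C). Qed.

Lemma tends_near_eq (f g : C -> C) l : tends_at_infty f l ->
  (\forall tau \near infty_nbhs C, g tau = f tau) -> tends_at_infty g l.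
Proof.
move=> /tendsP fl fg; apply/tendsP => e /fl fe.
by apply: filterS2 fg fe => tau ->.
Qed.

Lemma tends_neq (f g : C -> C) a b : tends_at_infty f a -> tends_at_infty g b ->
  a != b -> \forall tau \near infty_nbhs C, f tau != g tau.
Proof.
move=> /tendsP fa /tendsP gb ab.
have d0 : 0 < `|a - b| / 2 by rewrite divr_gt0// normr_gt0 subr_eq0.
apply: filterS2 (fa _ d0) (gb _ d0) => tau h1 h2; apply/negP => /eqP fg.
have : `|a - b| < `|a - b|.
  rewrite [ltRHS]splitr; apply: le_lt_trans (ltrD h1 h2).
  by rewrite -[`|b - _|]normrN fg opprB (le_trans _ (ler_normD _ _))// addrA subrK.
by rewrite ltxx.
Qed.

Lemma prod_if_split (f g : nat -> C) a b :
  \prod_(0 <= i < a + b) ('X - (if (i < a)%N then f i else g (i - a)%N)%:P) =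
  \prod_(0 <= i < a) ('X - (f i)%:P) * \prod_(0 <= i < b) ('X - (g i)%:P).
Proof.
rewrite !big_mkord big_split_ord/=; congr (_ * _); apply: eq_bigr => i _.
  by rewrite ltn_ord.
by rewrite ltnNge leq_addr/= addKn.
Qed.

Lemma mup_factor (p : {poly C}) z : p != 0 ->
  exists2 q : {poly C}, q.[z] != 0 & p = q * ('X - z%:P) ^+ mup z p.
Proof.
move=> p0; have [m [q]] := multiplicity_XsubC p z.
rewrite p0/= => qz pE; exists q => //.
suff -> : mup z p = m by [].
by rewrite pE mupMr// mup_XsubCX eqxx.
Qed.

(* Roots converging to distinct limits are eventually distinct, so the
   corresponding factors are coprime and can be multiplied. *)
Lemma glue_families (p : {poly C}) (q : C -> {poly C}) (zs : seq C) :
  (forall z, exists fs : nat -> C -> C,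
     (forall i, (i < mup z p)%N -> tends_at_infty (fs i) z) /\
     \forall tau \near infty_nbhs C,
       \prod_(0 <= i < mup z p) ('X - (fs i tau)%:P) %| q tau) ->
  uniq zs ->
  exists (rs : seq C) (fs : nat -> C -> C),
    [/\ forall z, count_mem z rs = ((z \in zs) * mup z p)%N,
        forall i, (i < size rs)%N -> tends_at_infty (fs i) rs`_i
      & \forall tau \near infty_nbhs C,
          \prod_(0 <= i < size rs) ('X - (fs i tau)%:P) %| q tau].
Proof.
move=> loc; elim: zs => [_|z zs IHzs /= /andP[zzs /IHzs]].
  exists [::], (fun _ _ => 0); split=> //.
  by apply: nearW => tau; rewrite big_geq// dvd1p.
move=> [rs [fs [crs tfs dfs]]]; have [gs [tgs dgs]] := loc z.
set k := mup z p in tgs dgs.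
exists (nseq k z ++ rs), (fun i => if (i < k)%N then gs i else fs (i - k)%N).
have ts i : (i < size rs)%N -> rs`_i != z.
  move=> irs; apply: contraTneq (mem_nth 0 irs) => ->.
  by rewrite -has_pred1 has_count crs (negbTE zzs).
split=> [x|i|].
- rewrite count_cat count_nseq crs in_cons /= [z == x]eq_sym.
  by have [->|_] := eqVneq x z; rewrite ?(negbTE zzs) ?mul1n ?mul0n ?addn0 ?add0n.
- rewrite size_cat size_nseq nth_cat size_nseq nth_nseq /=.
  move=> ilt; case: (ltnP i k) => ik; first exact: tgs.
  by apply: tfs; rewrite ltn_subLR.
have nq : \forall tau \near infty_nbhs C, forall (i : 'I_k) (j : 'I_(size rs)),
    gs i tau != fs j tau.
  apply: filter_forall => i; apply: filter_forall => j.
  by apply: tends_neq (tgs i (ltn_ord i)) (tfs j (ltn_ord j)) _; rewrite eq_sym ts.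
apply: filterS3 nq dfs dgs => tau neq h1 h2.
rewrite size_cat size_nseq.
under eq_bigr do rewrite (fun_if (fun h : C -> C => h tau)).
rewrite (prod_if_split (gs ^~ tau) (fs ^~ tau)).
rewrite Gauss_dvdp ?h1 ?h2//; apply/Pdiv.ClosedField.coprimepP => x.
rewrite !big_mkord prod_XsubC_enum.
rewrite root_prod_XsubC => /mapP[i _ ->]; rewrite horner_prod.
apply/prodf_neq0 => j _; rewrite hornerXsubC subr_eq0; exact: neq.
Qed.

End Families.

(** * Branches at one root of p_uv, assembled into families *)

Section PuiseuxFamilies.
Variable R : realType.
Local Notation C := (Cplx R).

Lemma finite_branches (M P1 : {poly C}) (zeta : C) k (y : C -> C) (eta : C) :
  (0 < k)%N -> 0 < eta ->
  (forall w, `|w| <= eta -> w != 0 ->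
     root (M - w ^- k *: ((zeta%:P - 'X) ^+ k * P1)) (zeta - w * y w)) ->
  (forall w w', `|w| <= eta -> `|w'| <= eta -> w != 0 -> w ^+ k = w' ^+ k ->
     w * y w = w' * y w' -> w = w') ->
  \forall tau \near infty_nbhs C, exists w : 'I_k -> C,
    distinct_kth_roots tau^-1 w /\
    \prod_i ('X - (zeta - w i * y (w i))%:P) %|
      M - tau *: ((zeta%:P - 'X) ^+ k * P1).
Proof.
move=> k0 eta0 rt inj.
apply: filterS2 (near_infty_neq0 C) (near_infty_small_root k0 eta0) => tau tau0 small.
have tauV0 : tau^-1 != 0 by rewrite invr_eq0.
have [w [winj wk]] := kth_roots_exist k0 tauV0.
have w0 i : w i != 0.
  by apply: contraNneq tauV0 => wi0; rewrite -(wk i) wi0 expr0n gtn_eqF.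
exists w; split=> //; apply: prod_distinct_dvd => [i j /addrI /oppr_inj e|i].
  by apply: winj; apply: inj e; rewrite ?small ?wk.
by have := rt _ (small _ (wk i)) (w0 i); rewrite wk invrK.
Qed.

Lemma finite_branch_small (y : C -> C) (L eta : C) k (e : C) : (0 < k)%N ->
  0 < eta -> (forall w, `|w| <= eta -> `|y w| <= L) -> 0 < e ->
  \forall tau \near infty_nbhs C, forall w, w ^+ k = tau^-1 -> `|w * y w| < e.
Proof.
move=> k0 eta0 yL e0.
have L0 : 0 <= L by apply: le_trans (yL 0 _); rewrite ?normr_ge0// normr0 ltW.
have d0 : 0 < e / (2 * (L + 1)) by rewrite divr_gt0// mulr_gt0// ltr_wpDl.
apply: filterS2 (near_infty_small_root k0 eta0) (near_infty_small_root k0 d0).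
move=> tau h1 h2 w wk; rewrite normrM.
apply: (@le_lt_trans _ _ (L * (e / (2 * (L + 1))))).
  by rewrite mulrC ler_pM// ?h2// yL// h1.
rewrite (le_lt_trans (half_bound L0 (ltW e0)))//.
by rewrite ltr_pdivrMr// ltr_pMr// ltr1n.
Qed.

Lemma local_families (m p : {poly C}) (zeta : C) : m != 0 -> p != 0 ->
  exists fs : nat -> C -> C,
    (forall i, (i < mup zeta p)%N -> tends_at_infty (fs i) zeta) /\
    \forall tau \near infty_nbhs C,
      \prod_(0 <= i < mup zeta p) ('X - (fs i tau)%:P) %| m - tau *: p.
Proof.
move=> m0 p0; have [p1 p1z pE] := mup_factor zeta p0.
have [m1 m1z mE] := mup_factor zeta m0.
set k := mup zeta p in pE *; set e := mup zeta m in mE.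
have tends_cst : tends_at_infty (fun=> zeta) zeta.
  by apply/tendsP => d d0; apply: nearW => tau; rewrite subrr normr0.
(* If k <= e then (X - zeta)^k divides both m and p, and constant branches suffice. Otherwise e
   branches are constant and the quotient by (X - zeta)^e supplies the other k - e. *)
have [ke|ek] := leqP k e.
  exists (fun _ _ => zeta); split=> //.
  apply: nearW => tau; rewrite prodr_const_nat subn0 mE pE dvdp_sub//.
    by rewrite dvdp_mull// dvdp_exp2l.
  by rewrite -mul_polyC !dvdp_mull.
pose k' := (k - e)%N; have k'0 : (0 < k')%N by rewrite subn_gt0.
(* The sign converts (X - zeta)^k' into the (zeta - X)^k' of [puiseux_finite]. *)
pose P1 := (-1) ^+ k' *: p1.
have P1z : P1.[zeta] != 0 by rewrite hornerZ mulf_neq0// signr_eq0.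
have x0 : m1.[zeta] / P1.[zeta] != 0 by rewrite mulf_neq0// invr_eq0.
have [b [_ bk]] := kth_roots_exist k'0 x0.
have b1k : b (Ordinal k'0) ^+ k' * P1.[zeta] = m1.[zeta] by rewrite bk divfK.
have [c [y [L [eta [_ _ eta0 hy [rt inj]]]]]] := puiseux_finite k'0 m1z P1z b1k.
have yL w : `|w| <= eta -> `|y w| <= L by move=> /hy [].
have near_w := finite_branches k'0 eta0 rt inj.
pose good tau (w : 'I_k' -> C) := distinct_kth_roots tau^-1 w /\
  \prod_i ('X - (zeta - w i * y (w i))%:P) %|
    m1 - tau *: ((zeta%:P - 'X) ^+ k' * P1).
(* One tuple of roots w is fixed for each tau, with the dummy value 0 where no suitable tuple
   exists. *)
have good_or tau : exists w, (exists w', good tau w') -> good tau w.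
  have [[w hw]|nw] := pselect (exists w, good tau w); first by exists w.
  by exists (fun=> 0).
have [W hW] := choice good_or.
pose gs i tau := zeta - W tau (insubd (Ordinal k'0) i)
  * y (W tau (insubd (Ordinal k'0) i)).
have tgs i : tends_at_infty (gs i) zeta.
  apply/tendsP => d d0; apply: filterS2 near_w (finite_branch_small k'0 eta0 yL d0).
  by move=> tau /hW [[_ wk] _] small; rewrite opprB addrC subrK small.
exists (fun i => if (i < e)%N then (fun=> zeta) else gs (i - e)%N); split=> [i _|].
  by case: ifP.
apply: filterS near_w => tau /hW [_ hd].
rewrite -{1}(subnKC (ltnW ek)) -/k'.
under eq_bigr do rewrite (fun_if (fun h : C -> C => h tau)).
rewrite (prod_if_split (fun=> zeta) (gs ^~ tau)).
have -> : m - tau *: p = ('X - zeta%:P) ^+ e *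
    (m1 - tau *: ((zeta%:P - 'X) ^+ k' * P1)).
  have -> : (zeta%:P - 'X) ^+ k' * P1 = ('X - zeta%:P) ^+ k' * p1.
    rewrite -opprB exprNn /P1 -scalerAr -mul_polyC rmorphXn rmorphN rmorph1.
    by rewrite mulrA mulrA -exprMn mulrNN mulr1 expr1n mul1r.
  rewrite mE pE -{1}(subnK (ltnW ek)) exprD -/k' mulrBr -scalerAr.
  by congr (_ - _ *: _); rewrite ?mulrA mulrC// -mulrA [p1 * _]mulrC.
rewrite prodr_const_nat subn0 dvdp_mul2l; last first.
  by rewrite expf_neq0// polyXsubC_eq0.
rewrite big_mkord (eq_bigr (fun i : 'I_k' => 'X - (zeta - W tau i * y (W tau i))%:P))//.
by move=> i _; rewrite /gs; congr ('X - (zeta - W tau _ * y (W tau _))%:P);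
  apply/val_inj; rewrite val_insubd ltn_ord.
Qed.

End PuiseuxFamilies.

(** * Coefficients of the expansions *)

Section PowerCoefficients.
Variable F : numFieldType.
Implicit Types p q : {poly F}.

Lemma coefM1 p q : (p * q)`_1 = p`_0 * q`_1 + p`_1 * q`_0.
Proof. by rewrite coefM !big_ord_recl big_ord0 addr0. Qed.

Lemma coefM2 p q : (p * q)`_2 = p`_0 * q`_2 + p`_1 * q`_1 + p`_2 * q`_0.
Proof. by rewrite coefM !big_ord_recl big_ord0 addr0 addrA. Qed.

Lemma coef0X p n : (p ^+ n)`_0 = p`_0 ^+ n.
Proof. by rewrite -!horner_coef0 horner_exp. Qed.

Lemma coef1X p n : p`_0 != 0 ->
  (p ^+ n)`_1 = p`_0 ^+ n * (n%:R * (p`_1 / p`_0)).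
Proof.
move=> p0; elim: n => [|n IHn]; first by rewrite expr0 coef1 mul0r mulr0.
by rewrite exprSr coefM1 IHn coef0X exprSr -natr1; field.
Qed.

Lemma coef2X p n : p`_0 != 0 ->
  (p ^+ n)`_2 = p`_0 ^+ n *
    (n%:R * (p`_2 / p`_0) + n%:R * (n%:R - 1) / 2 * (p`_1 / p`_0) ^+ 2).
Proof.
move=> p0; elim: n => [|n IHn].
  by rewrite expr0 coef1 !mul0r addr0 mulr0.
by rewrite exprSr coefM2 IHn coef1X// coef0X [p`_0 ^+ n.+1]exprSr
  -[n.+1%:R]natr1; field.
Qed.

Lemma dvd_Xn_mull p q n : p.[0] != 0 -> 'X^n %| p * q -> 'X^n %| q.
Proof.
move=> p0; rewrite Gauss_dvdpr// coprimep_sym coprimep_expr//.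
by rewrite coprimepX rootE.
Qed.

End PowerCoefficients.

Section Expansions.
Variable R : realType.
Local Notation C := (Cplx R).

Lemma cvg_seq_scale (a l : C) (f : nat -> C) :
  f @ \oo --> l -> (fun N => a * f N) @ \oo --> a * l.
Proof.
move=> /cvg_seqP fl; apply/cvg_seqP => e e0.
have d0 : 0 < e / (2 * (`|a| + 1)) by rewrite divr_gt0// mulr_gt0// ltr_wpDl.
have [M h] := fl _ d0; exists M => N /h fN.
rewrite -mulrBr normrM (le_lt_trans (ler_wpM2l _ (ltW fN)))//.
rewrite (le_lt_trans (half_bound _ (ltW e0)))//.
by rewrite ltr_pdivrMr// ltr_pMr// ltr1n.
Qed.

(** As m does not vanish at zeta, the order k of the zero of p is the index of the first nonzero
    a_j. In the application [a j] is the resolvent moment of exponent j + 1. *)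
Lemma resolvent_expansion (m p r : {poly C}) (zeta : C) (a : nat -> C) k :
  p != 0 -> m.[zeta] != 0 -> mup zeta p = k ->
  p = m * (\sum_(j < k.+2) a j *: (zeta%:P - 'X) ^+ j) +
      (zeta%:P - 'X) ^+ k.+2 * r ->
  a k != 0 /\
  p = (zeta%:P - 'X) ^+ k *
      (m * ((a k)%:P + a k.+1 *: (zeta%:P - 'X)) + (zeta%:P - 'X) ^+ 2 * r).
Proof.
move=> p0 mz pk pE; set D := zeta%:P - 'X in pE *.
have Dz : D.[zeta] = 0 by rewrite !hornerE subrr.
have [q qz qE] := mup_factor zeta p0; rewrite pk in qE.
have {}qE : p = D ^+ k * ((-1) ^+ k *: q).
  have -> : p = q * ((-1) ^+ k *: D ^+ k).
    by rewrite -exprZn scaleN1r /D opprB.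
  by rewrite -!scalerAr mulrC.
(* The substitution of zeta - X for X is an involution: composing with D moves zeta to 0 and powers
   of D to powers of X. *)
have DD : D \Po D = 'X by rewrite /D comp_polyB comp_polyC comp_polyX opprB addrC subrK.
have powD i : D ^+ i \Po D = 'X^i by rewrite rmorphXn/= DD.
have D0 : D != 0 by rewrite -oppr_eq0 opprB polyXsubC_eq0.
have a0 j : (j < k)%N -> a j = 0.
  move=> jk; suff /dvd_XnP/(_ j jk) : 'X^k %| \poly_(i < k.+2) a i.
    by rewrite coef_poly (ltn_trans jk)// (ltn_trans (ltnSn k)).
  have mD0 : (m \Po D).[0] != 0.
    by rewrite horner_comp /D !hornerE subr0.
  apply: (dvd_Xn_mull mD0).
  have -> : (m \Po D) * \poly_(i < k.+2) a i =
      'X^k * (((-1) ^+ k *: q) \Po D) - 'X^(k.+2) * (r \Po D).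
    have := congr1 (comp_poly D) pE; rewrite {1}qE
      comp_polyM powD comp_polyD 2!comp_polyM.
    rewrite powD raddf_sum => ->; rewrite addrK poly_def; congr (_ * _).
    by apply: eq_bigr => i _; rewrite -[RHS]/((a i *: D ^+ i) \Po D) comp_polyZ powD.
  by apply: dvdp_sub; rewrite dvdp_mulr// dvdp_exp2l// (leq_addl 2 k).
have pE2 : p = D ^+ k * (m * ((a k)%:P + a k.+1 *: D) + D ^+ 2 * r).
  rewrite pE !big_ord_recr/= big1 ?add0r => [|i _]; last by rewrite a0 ?scale0r.
  by rewrite -addn2 -!mul_polyC exprSr exprD; ring.
(* If a_k vanished, cancelling D^k and evaluating at zeta would give q(zeta) = 0. *)
split=> //; apply: contraNneq qz => ak0.
have := mulfI (expf_neq0 k D0) (etrans (esym qE) pE2).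
move=> /(congr1 (fun t => t.[zeta])).
rewrite hornerZ hornerD !hornerM hornerD hornerZ hornerC Dz ak0.
by rewrite !(mulr0, mul0r, addr0) => /eqP; rewrite mulf_eq0 signr_eq0.
Qed.

Lemma finite_expansion (m r : {poly C}) (zeta a1 a2 b1 : C) k :
  (0 < k)%N -> m.[zeta] != 0 -> a1 != 0 -> b1 ^+ k = a1^-1 ->
  exists (g : C -> C) (b : nat -> C),
  [/\ forall e, 0 < e -> \forall tau \near infty_nbhs C,
        forall w, w ^+ k = tau^-1 -> `|zeta - g w| < e,
      power_series_at_0 g zeta b,
      \forall tau \near infty_nbhs C, exists w : 'I_k -> C,
        distinct_kth_roots tau^-1 w /\
        \prod_i ('X - (g (w i))%:P) %|
          m - tau *: ((zeta%:P - 'X) ^+ k *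
             (m * (a1%:P + a2 *: (zeta%:P - 'X)) + (zeta%:P - 'X) ^+ 2 * r))
    & b 1%N = b1 /\ b 2%N = - (k%:R^-1 * (b1 ^+ 2 * a2 / a1))].
Proof.
move=> k0 mz a10 b1k; set P1 := _ + _ * r.
have b10 : b1 != 0.
  by apply: contraNneq a10 => b1E; rewrite -invr_eq0 -b1k b1E expr0n gtn_eqF.
have P1z : P1.[zeta] = m.[zeta] * a1.
  have Dz : (zeta%:P - 'X).[zeta] = 0 by rewrite !hornerE subrr.
  rewrite /P1 hornerD !hornerM hornerD hornerZ hornerC Dz.
  by rewrite !(mul0r, mulr0, addr0).
have P1z0 : P1.[zeta] != 0 by rewrite P1z mulf_neq0.
have b1P : b1 ^+ k * P1.[zeta] = m.[zeta] by rewrite b1k P1z mulrCA mulVf// mulr1.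
have [c [y [L [eta [c0 cX eta0 hy [rt inj]]]]]] := puiseux_finite k0 mz P1z0 b1P.
have yL w : `|w| <= eta -> `|y w| <= L by move=> /hy [].
(* The factor w in front of y shifts indices: b_i is the coefficient of index i - 1 of y. *)
exists (fun w => zeta - w * y w), (fun i => c i.-1); split.
- move=> e e0; apply: filterS (finite_branch_small k0 eta0 yL e0) => tau h w /h.
  by rewrite opprB addrC subrK.
- apply: filterS (nbhs0_lt eta0) => w /ltW /hy [cy _].
  apply/cvg_seqP => e e0.
  have [M h] := (cvg_seqP _ _).1 (cvg_seq_scale (a := w) cy) e e0.
  exists M.+1 => -[//|N]; rewrite ltnS => /h.
  have -> : \sum_(1 <= i < N.+1) c i.-1 * w ^+ i =
      w * \sum_(0 <= i < N) c i * w ^+ i.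
    by rewrite big_add1/= mulr_sumr; apply: eq_bigr => i _; rewrite exprS mulrCA.
  by rewrite -normrN; congr (`|_| < _); ring.
- exact: (finite_branches k0 eta0 rt inj).
(* Modulo w^2 the remainder r drops out and the factor m is a unit, leaving Y^k (a1 + a2 w Y) = 1,
   whose coefficient of degree 1 determines c_1. *)
- split=> //=; have := cX 2%N; rewrite /=.
  set Y := \poly_(i < 2) c i; set Lam := zeta%:P - 'X * Y.
  have DL : (zeta%:P - 'X) \Po Lam = 'X * Y.
    by rewrite comp_polyB comp_polyC comp_polyX /Lam opprB addrC subrK.
  have -> : (m \Po Lam) - Y ^+ k * (P1 \Po Lam) =
      (m \Po Lam) * (1 - Y ^+ k * (a1%:P + a2 *: ('X * Y)))
      - 'X^2 * (Y ^+ k * Y ^+ 2 * (r \Po Lam)).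
    rewrite /P1; move: (zeta%:P - 'X) DL => D DL.
    rewrite !(comp_polyD, comp_polyM, comp_polyZ, comp_polyC) DL.
    by rewrite -mul_polyC; ring.
  have mL : (m \Po Lam).[0] != 0 by
    rewrite horner_comp /Lam hornerD hornerN hornerM hornerX hornerC mul0r subr0.
  rewrite dvdp_subl; last exact: dvdp_mulr.
  move=> XY.
  have /dvd_XnP/(_ 1%N isT)/eqP := dvd_Xn_mull mL XY.
  have Y0 : Y`_0 = b1 by rewrite coef_poly c0.
  have Y1 : Y`_1 = c 1%N by rewrite coef_poly.
  rewrite coefB coef1 coefM1 coef0X coef1X ?Y0// !coefD !coefC !coefZ
    !coefXM/= Y0 Y1 b1k.
  rewrite !(mulr0, addr0, add0r, sub0r) oppr_eq0 => /eqP h.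
  have kR : (k%:R : C) != 0 by rewrite pnatr_eq0 -lt0n.
  have -> : c 1%N = (a1^-1 * (a2 * b1) + a1^-1 * (k%:R * (c 1%N / b1)) * a1)
    * b1 / k%:R - k%:R^-1 * (b1 ^+ 2 * a2 / a1).
    by field; rewrite kR b10 a10.
  by rewrite h !mul0r sub0r.
Qed.

(** The factor Y^(K+2) brings in the expansion of X^(K+2) p. As r has degree below l, it is
    homogenised in degree l - 1 and leaves w^3 in front; modulo w^3 and up to the factor from m, the
    equation reads Y^(K+2) = s Y^2 + s1 w Y + s2 w^2. *)
Lemma hom_moments (m p r Y : {poly C}) l K (s s1 s2 : C) :
  (0 < K)%N -> (K <= l)%N -> (size m <= l.+1)%N -> (size p <= (l - K).+1)%N ->
  (size r <= l)%N ->
  'X^(K + 2) * p = m * (s *: 'X^2 + s1 *: 'X + s2%:P) + r ->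
  Y ^+ (K + 2) * (hom l m - hom (l - K) p).[Y] =
  (hom l m).[Y] * (Y ^+ (K + 2) - (s *: Y ^+ 2 + s1 *: ('X * Y) + s2 *: 'X^2))
  - 'X^3 * (hom l.-1 r).[Y].
Proof.
move=> K0 Kl sm sp sr pE; have l0 : (0 < l)%N by apply: leq_trans Kl.
apply: (@poly_eq_off_roots _ 'X) => [|x]; first by rewrite polyX_eq0.
rewrite hornerX => x0; rewrite [_.[Y]]hornerD hornerN.
rewrite hornerM horner_exp hornerD hornerN !horner_hom ?prednK//.
rewrite hornerD hornerN !hornerM !horner_hom ?prednK//.
rewrite !(hornerD, hornerN, hornerZ, hornerM, horner_exp, hornerX, hornerXn).
set t := Y.[x] / x; have YE : Y.[x] = t * x by rewrite /t divfK.
have pt : t ^+ (K + 2) * p.[t] = m.[t] * (s * t ^+ 2 + s1 * t + s2) + r.[t].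
  have := congr1 (horner ^~ t) pE; rewrite hornerM hornerXn hornerD hornerM => ->.
  by rewrite !(hornerD, hornerZ, hornerX, hornerXn, hornerC).
have xl : x ^+ l = x ^+ (l - K) * x ^+ K by rewrite -exprD subnK.
have x3 : x ^+ 3 * (x ^+ l.-1 * r.[t]) = x ^+ l * x ^+ 2 * r.[t].
  by rewrite mulrA -exprD -exprD -{2}(prednK l0) addn2 add3n.
rewrite x3 mulrBr YE.
have -> : (t * x) ^+ (K + 2) * (x ^+ (l - K) * p.[t]) =
    x ^+ l * x ^+ 2 * (t ^+ (K + 2) * p.[t]).
  by rewrite exprMn [x ^+ (K + 2)]exprD xl; ring.
by rewrite pt; ring.
Qed.

Lemma infinite_expansion (m p r : {poly C}) l K (s s1 s2 c_m1 : C) :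
  (0 < K)%N -> (K <= l)%N -> (size m <= l.+1)%N -> m`_l = 1 ->
  (size p <= (l - K).+1)%N -> p`_(l - K) = s -> s != 0 -> c_m1 ^+ K = s ->
  (size r <= l)%N ->
  'X^(K + 2) * p = m * (s *: 'X^2 + s1 *: 'X + s2%:P) + r ->
  exists (f : C -> C) (c : nat -> C),
  [/\ laurent_at_infty f c,
      \forall tau \near infty_nbhs C, exists z : 'I_K -> C,
        distinct_kth_roots tau z /\
        \prod_i ('X - (f (z i))%:P) %| m - tau *: p
    & [/\ c 0%N = c_m1, c 1%N = K%:R^-1 * (s1 / s)
        & c 2%N = K%:R^-1 * (c_m1 * s)^-1 *
            (s2 - K.+1%:R / (2 * K%:R) * (s1 ^+ 2 / s))]].
Proof.
move=> K0 Kl sm ml sp ps s0 cK sr pE.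
have c0 : c_m1 != 0.
  by apply: contraNneq s0 => cE; rewrite -cK cE expr0n gtn_eqF.
rewrite -ps in s0 cK *.
have [c [y [eta [cc0 cX eta0 hy [rt inj]]]]] := puiseux_infinite K0 Kl sm ml sp s0 cK.
rewrite ps in s0 cK *.
(* With w = 1/z the branch y(w) / w becomes z y(1/z), so the term c_m w^m yields c_m z^(1-m). *)
exists (fun z => y z^-1 * z), c; split.
- apply: filterS2 (near_infty_neq0 C) (near_infty_small_root (ltn0Sn 0) eta0)
    => z z0 small.
  have /hy cy : `|z^-1| <= eta by apply: small.
  have := cvg_seq_scale (a := z) cy; rewrite mulrC; apply: cvg_trans.
  apply: near_eq_cvg; apply: nearW => N; rewrite mulr_sumr; apply: eq_bigr => i _.
  rewrite mulrCA; congr (_ * _).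
  by rewrite expfzDr// expr1z -invr_expz -exprnP exprVn.
- apply: filterS2 (near_infty_neq0 C) (near_infty_small_root K0 eta0) => tau tau0 small.
  have [z [zinj zK]] := kth_roots_exist K0 tau0.
  have z0 i : z i != 0.
    by apply: contraNneq tau0 => zi0; rewrite -(zK i) zi0 expr0n gtn_eqF.
  have sz i : `|(z i)^-1| <= eta by apply: small; rewrite exprVn zK.
  exists z; split=> //; apply: prod_distinct_dvd => [i j e|i].
    apply: zinj; apply: invr_inj; apply: inj; rewrite ?sz ?invr_eq0 ?z0 ?invrK//.
    by rewrite !exprVn !zK.
  have := rt _ (sz i); rewrite invr_eq0 => /(_ (z0 i)).
  by rewrite exprVn invrK zK invrK.
- have := dvdp_mull ((\poly_(i < 3) c i) ^+ (K + 2)) (cX 3%N).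
  rewrite (hom_moments _ K0 Kl sm sp sr pE).
  set Y := \poly_(i < 3) c i.
  have Y0 : Y`_0 = c_m1 by rewrite coef_poly.
  have Y1 : Y`_1 = c 1%N by rewrite coef_poly.
  have Y2 : Y`_2 = c 2%N by rewrite coef_poly.
  rewrite dvdp_subl; last exact: dvdp_mulr.
  (* The factor from m takes the value c_m1^l at w = 0 and cancels modulo w^3. The coefficient of
     degree 1 then gives c_1, and that of degree 2 gives c_2. *)
  move=> XY; have mL : (hom l m).[Y].[0] != 0.
    have -> : (hom l m).[Y].[0] = (map_poly (horner_eval 0) (hom l m)).[Y.[0]].
      by rewrite -[Y.[0]]/(horner_eval 0 Y) horner_map.
    by rewrite hom_at0 ml scale1r hornerXn horner_coef0 Y0 expf_neq0.
  have /dvd_XnP XY2 := dvd_Xn_mull mL XY.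
  have Kn : (K%:R : C) != 0 by rewrite pnatr_eq0 -lt0n.
  have cK2 : c_m1 ^+ (K + 2) = s * c_m1 ^+ 2 by rewrite exprD cK.
  have c1E : c 1%N = K%:R^-1 * (s1 / s).
    have /eqP := XY2 1%N isT; rewrite coefB !coefD !coefZ coefXn coefXM/=.
    rewrite !coef1X ?Y0// Y1 cK2 mulr0 addr0 natrD => h.
    suff -> : c 1%N = s1 / (K%:R * s) by field; rewrite Kn s0.
    apply/eqP; rewrite eq_sym -subr_eq0.
    have -> : s1 / (K%:R * s) - c 1%N =
      - (s * c_m1 ^+ 2 * ((K%:R + 2) * (c 1%N / c_m1)) -
      (s * (c_m1 ^+ 2 * (2 * (c 1%N / c_m1))) + s1 * c_m1)) / (K%:R * s * c_m1).
      by field; rewrite Kn s0 c0.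
    by rewrite (eqP h) oppr0 mul0r.
  split=> //.
  have /eqP := XY2 2%N isT; rewrite coefB !coefD !coefZ coefXn coefXM/=.
  rewrite !coef2X ?Y0// Y1 Y2 cK2 mulr1 natrD c1E => h.
  apply/eqP; rewrite -subr_eq0 -[K.+1%:R]natr1.
  set rhs := (X in c 2%N - X).
  (* The difference from the claimed value is the vanishing coefficient of degree 2 divided by K s
     c_m1. *)
  have -> : c 2%N - rhs = (s * c_m1 ^+ 2 * ((K%:R + 2) * (c 2%N / c_m1) +
      (K%:R + 2) * (K%:R + 2 - 1) / 2 * (K%:R^-1 * (s1 / s) / c_m1) ^+ 2) -
      (s * (c_m1 ^+ 2 * (2 * (c 2%N / c_m1) +
         2 * (2 - 1) / 2 * (K%:R^-1 * (s1 / s) / c_m1) ^+ 2)) +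
       s1 * (K%:R^-1 * (s1 / s)) + s2)) / (K%:R * s * c_m1).
    by rewrite /rhs; field; rewrite Kn s0 c0.
  by rewrite (eqP h) mul0r.
Qed.

End Expansions.

(** * Degree and top coefficients of p_uv *)

Section PuvShape.
Variables (C : numClosedFieldType) (n : nat).
Variables (A : 'M[C]_n.+1) (w : 'rV[C]_n.+1) (u : 'cV[C]_n.+1).
Let m := mxminpoly A.
Let l := degree_mxminpoly A.
Let p := puv A w u.
Let s i := mform w u (A ^+ i).

Lemma puv_eq0 : (forall i, (i < l)%N -> s i = 0) -> p = 0.
Proof.
move=> s0; apply: big1 => i _; apply: big1 => j _.
have il : (i <= l)%N by rewrite -ltnS -(size_mxminpoly A).
have := s0 j (leq_trans (ltn_ord j) il); rewrite /s => ->.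
by rewrite mulr0 scale0r.
Qed.

Variable kappa : nat.
Hypotheses (kl : (kappa < l)%N) (s0 : forall i, (i < kappa)%N -> s i = 0).
Hypothesis sk : s kappa != 0.

(** In [puv_moments] with J = kappa + 1 the first kappa moments vanish, so X^(kappa+1) p is s_kappa
    m plus a remainder of degree below l. *)
Lemma coef_puv j : p`_(l - kappa.+1 + j) = if j == 0%N then s kappa else 0.
Proof.
have := congr1 (fun q : {poly C} => q`_(l + j)) (puv_moments A w u kappa.+1).
rewrite coefXnM ltnNge (leq_trans kl) ?leq_addr//= -addnBAC// => ->.
rewrite big_ord_recr big1 => [|i _]; last first.
  by have := s0 (ltn_ord i); rewrite /s => ->; rewrite scale0r.
rewrite /= add0r subnn expr0 alg_polyC coefD coefMC.
rewrite [X in _ + X]nth_default ?addr0; last first.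
  by rewrite (leq_trans (size_puv _ _ _))// leq_addr.
case: eqP => [->|/eqP j0].
  have := mxminpoly_monic A; rewrite monicE /lead_coef size_mxminpoly /= addn0.
  by move=> /eqP ->; rewrite mul1r.
by rewrite nth_default ?mul0r// size_mxminpoly -addn1 leq_add2l lt0n.
Qed.

Lemma size_puv_eq : size p = (l - kappa.+1).+1.
Proof.
apply/anti_leq/andP; split.
  apply/leq_sizeP => j lj.
  by rewrite -(subnKC (ltnW lj)) coef_puv subn_eq0 leqNgt lj.
rewrite ltnNge; apply: contra sk => /leq_sizeP /(_ _ (leqnn _)).
by rewrite -[(l - _)%N]addn0 coef_puv /= => ->.
Qed.

Lemma lead_puv : p`_(l - kappa.+1) = s kappa.
Proof. by rewrite -[(l - _)%N]addn0 coef_puv. Qed.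

Lemma puv_moments3 : 'X^(kappa.+1 + 2) * p =
  m * (s kappa *: 'X^2 + s kappa.+1 *: 'X + (s kappa.+2)%:P)
  + puv A (w *m A ^+ (kappa.+1 + 2)) u.
Proof.
rewrite /p puv_moments addn2; congr (_ * _ + _).
rewrite 3!big_ord_recr big1 => [|i _] /=; last first.
  by have := s0 (ltn_ord i); rewrite /s => ->; rewrite scale0r.
rewrite add0r subnn subSnn expr0 alg_polyC.
by have -> : (kappa.+2 - kappa = 2)%N by rewrite -addn2 addKn.
Qed.

End PuvShape.

(** * Assembly of the statements *)

Theorem theorem1 (R : realType) (n : nat) (A : 'M[Cplx R]_n.+1)
    (u v : 'cV[Cplx R]_n.+1) :
  let l := degree_mxminpoly A in
  let B := rank_one_update A u v in
  let s := moment A u v in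
  let a := resolvent_moment A u v in
  (exists p : {poly Cplx R}, is_puv A u v p) /\
  forall p : {poly Cplx R}, is_puv A u v p ->
    ((forall i : nat, (i < l)%N -> s i = 0) ->
       p = 0 /\ forall tau : Cplx R, sigma (B tau) = sigma A)
    /\
    (forall kappa : nat, (kappa < l)%N ->
       (forall i : nat, (i < kappa)%N -> s i = 0) -> s kappa != 0 ->
       [/\ (* (i) *)
           size p = (l - kappa - 1).+1,
           (* (ii) *)
           exists r : 'I_(l - kappa - 1) -> Cplx R,
             root_family p r /\
             exists lam : 'I_(l - kappa - 1) -> Cplx R -> Cplx R,
               (forall tau, eigenvalue_family (B tau) (lam ^~ tau)) /\
               (forall j, tends_at_infty (lam j) (r j)),
           (* (iii) *)
           forall c_m1 : Cplx R, c_m1 ^+ kappa.+1 = s kappa ->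
             exists (lam : 'I_kappa.+1 -> Cplx R -> Cplx R)
                    (f : Cplx R -> Cplx R) (c : nat -> Cplx R),
               [/\ forall tau, eigenvalue_family (B tau) (lam ^~ tau),
                   laurent_at_infty f c,
                   \forall tau \near infty_nbhs (Cplx R),
                     exists z : 'I_kappa.+1 -> Cplx R,
                       distinct_kth_roots tau z /\
                       forall j, lam j tau = f (z j)
                 & [/\ c 0%N = c_m1,
                       c 1%N = kappa.+1%:R^-1 * (s kappa.+1 / s kappa)
                     & c 2%N = kappa.+1%:R^-1 * (c_m1 * s kappa)^-1 *
                         (s kappa.+2 - kappa.+2%:R / (2 * kappa.+1%:R) *
                                       (s kappa.+1 ^+ 2 / s kappa))]]
         & (* (iv) *)
           forall (zeta : Cplx R) (k : nat), (0 < k)%N -> mup zeta p = k ->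
             ~~ root (mxminpoly A) zeta ->
             a zeta k.+1 != 0 /\
             forall b_1 : Cplx R, b_1 ^+ k = (a zeta k.+1)^-1 ->
               exists (lam : 'I_k -> Cplx R -> Cplx R)
                      (g : Cplx R -> Cplx R) (b : nat -> Cplx R),
                 [/\ forall tau, eigenvalue_family (B tau) (lam ^~ tau),
                     forall j, tends_at_infty (lam j) zeta,
                     power_series_at_0 g zeta b,
                     \forall tau \near infty_nbhs (Cplx R),
                       exists w : 'I_k -> Cplx R,
                         distinct_kth_roots tau^-1 w /\
                         forall j, lam j tau = g (w j)
                   & b 1%N = b_1 /\
                     b 2%N = - (k%:R^-1 * (b_1 ^+ 2 * a zeta k.+2 /
                                           a zeta k.+1))]]).
Proof.
move=> l B s a; have puvP (q : {poly Cplx R}) : is_puv A u v q -> q = puv A (v ^t*) u.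
  by move=> qP; apply: puv_unique => x /qP.
have ex : is_puv A u v (puv A (v ^t*) u) by move=> x xA; rewrite horner_puv.
split; first by exists (puv A (v ^t*) u).
move=> p /puvP {ex} pE; split.
  move=> s0; have p0 : p = 0 by rewrite pE; apply: puv_eq0.
  split=> [//|tau]; have m0 := monic_neq0 (mxminpoly_monic A).
  (* With p = 0, cancelling m leaves equal characteristic polynomials. *)
  have := char_poly_update A u v tau; rewrite -pE p0 scaler0 subr0 mulrC.
  move=> /(mulIf m0) cB; apply/seteqP.
  by split=> x; rewrite /sigma/= !eigenvalue_root_char /B cB.
move=> kappa kl s0 sk.
have dE : (l - kappa - 1 = l - kappa.+1)%N by rewrite -subnDA addn1.
have sp : size p = (l - kappa - 1).+1 by rewrite dE pE; apply: size_puv_eq.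
have p0 : p != 0 by rewrite -size_poly_gt0 sp.
have m0 : mxminpoly A != 0 by apply: monic_neq0 (mxminpoly_monic A).
have qB tau d : d %| mxminpoly A - tau *: p -> d %| char_poly (B tau).
  by rewrite pE; apply: dvd_char_poly_update.
split; first exact: sp.
- have [rp rpE] := closed_field_poly_normal p.
  have mupE x : mup x p = count_mem x rp.
    rewrite rpE -mul_polyC mupMr ?mu_prod_XsubC//.
    by rewrite rootC lead_coef_eq0.
  have srp : size rp = (l - kappa - 1)%N.
    by move: sp; rewrite rpE size_scale ?lead_coef_eq0// size_prod_XsubC => -[].
  (* Gluing runs over the distinct roots of p; [rs] then lists all roots of p with multiplicity. *)
  have [rs [fs [crs tfs dfs]]] := glue_families
    (fun z => local_families z m0 p0) (undup_uniq rp).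
  have rs_rp : perm_eq rs rp.
    apply/allP => x _; apply/eqP; rewrite crs mem_undup mupE.
    by case: (boolP (x \in rp)) => [_|/count_memPn ->]; rewrite ?mul1n ?muln0.
  have srs : size rs = (l - kappa - 1)%N by rewrite (perm_size rs_rp).
  move: (l - kappa - 1)%N srs => d srs {sp srp dE}; subst d.
  exists (fun i => rs`_i); split.
    move=> x; rewrite card_pred_eq_count (map_comp (nth 0 rs) val) val_enum_ord.
    by rewrite -/(mkseq _ _) mkseq_nth mupE (permP rs_rp).
  have [|lam [lamB lamE]] := @extend_eigenvalue_family _ n B (size rs)
    (fun tau f => forall j, f j = fs j tau).
    apply: filterS dfs => tau h; exists (fun j => fs j tau); split=> //.
    by apply: qB; move: h; rewrite big_mkord.
  exists lam; split=> // j; apply: tends_near_eq (tfs j (ltn_ord j)) _.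
  by apply: filterS lamE => tau; apply.
- move=> c_m1 cK.
  have ml : (mxminpoly A)`_l = 1.
    by have := mxminpoly_monic A; rewrite monicE /lead_coef size_mxminpoly => /eqP.
  have sm : (size (mxminpoly A) <= l.+1)%N by rewrite size_mxminpoly.
  have sp' : (size p <= (l - kappa.+1).+1)%N by rewrite sp dE.
  have lp : p`_(l - kappa.+1) = s kappa by rewrite pE; apply: lead_puv.
  have pX := puv_moments3 s0; rewrite -pE in pX.
  have [f [c [fc near_z cE]]] := infinite_expansion (ltn0Sn kappa) kl sm ml sp' lp sk cK
    (size_puv _ _ _) pX.
  have [|lam [lamB lamE]] := @extend_eigenvalue_family _ n B kappa.+1
    (fun tau h => exists z : 'I_kappa.+1 -> Cplx R,
       distinct_kth_roots tau z /\ forall j, h j = f (z j)).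
    apply: filterS near_z => tau [z [zr zd]]; exists (fun j => f (z j)).
    by split; [apply: qB | exists z].
  by exists lam, f, c.
- move=> zeta k k0 pk mz; have mz0 : (mxminpoly A).[zeta] != 0 by rewrite -rootE.
  have zA : zeta%:M - A \is a GRing.unit.
    by rewrite unit_char_poly -rootE -root_mxminpoly.
  have pr := puv_resolvents (v ^t*) u k.+2 zA; rewrite -pE in pr.
  (* The shift by one makes [a zeta k.+1] the first nonzero coefficient of the expansion at zeta. *)
  have [ak {}pr] := resolvent_expansion (a := fun j => a zeta j.+1) p0 mz0 pk pr.
  split=> // b1 b1k.
  have [g [b [g_small gb near_w bE]]] := finite_expansion
    (puv A (v ^t* *m (zeta%:M - A) ^- k.+2) u) (a zeta k.+2) k0 mz0 ak b1k.
  rewrite -pr in near_w.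
  have [|lam [lamB lamE]] := @extend_eigenvalue_family _ n B k
    (fun tau h => exists w : 'I_k -> Cplx R,
       distinct_kth_roots tau^-1 w /\ forall j, h j = g (w j)).
    apply: filterS near_w => tau [w [wr wd]]; exists (fun j => g (w j)).
    by split; [apply: qB | exists w].
  exists lam, g, b; split=> // j; apply/tendsP => e /g_small ge.
  by apply: filterS2 ge lamE => tau h [w [[_ wk] ->]]; apply: h.
Qed.
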